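(* Let $V\subseteq W$ be transitive models of ZFC such that $(V,W)$ satisfies the $\kappa$-covering property and the $\tau$-approximation property for some $\tau<\kappa$, where $\kappa$ is inaccessible in $V$, and let $\lambda\ge\kappa$ be a cardinal of $V$. Then $P^W_\kappa\lambda\setminus P^V_\kappa\lambda\in I^W_{\mathrm{IT}}[\kappa,\lambda]$; furthermore $F^V_{\mathrm{IT}}[\kappa,\lambda]\subseteq F^W_{\mathrm{IT}}[\kappa,\lambda]$. In particular, if $W\models\mathsf{ITP}(\kappa,\lambda)$, then $V\models\mathsf{ITP}(\kappa,\lambda)$.
   Context: $P_\kappa\lambda=\{a\subseteq\lambda:|a|<\kappa\}$. A $P_\kappa\lambda$-list is $D=\langle d_a:a\in P_\kappa\lambda\rangle$ with $d_a\subseteq a$; thin means there is a club $C\subseteq P_\kappa\lambda$ with $|\{d_a\cap c : c\subseteq a\in P_\kappa\lambda\}|<\kappa$ for all $c\in C$. $d\subseteq\lambda$ is an ineffable branch of $D$ if $d\cap a=d_a$ for all $a$ in some stationary $S\subseteq P_\kappa\lambda$. $\mathsf{ITP}(\kappa,\lambda)$: every thin $P_\kappa\lambda$-list has an ineffable branch. For $A\subseteq P_\kappa\lambda$, $D$ is $A$-effable if for every $S\subseteq A$ stationary in $P_\kappa\lambda$ there are $a,b\in S$, $a\subseteq b$, $d_a\ne d_b\cap a$. $I_{\mathrm{IT}}[\kappa,\lambda]=\{A\subseteq P_\kappa\lambda : \text{there is a thin } A\text{-effable list}\}$ and $F_{\mathrm{IT}}[\kappa,\lambda]=\{A\subseteq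 P_\kappa\lambda : P_\kappa\lambda\setminus A\in I_{\mathrm{IT}}[\kappa,\lambda]\}$ is the dual filter; superscripts indicate the model of computation. $(V,W)$ has the $\mu$-covering property if every $x\in W$, $x\subseteq V$, $|x|^W<\mu$ is contained in some $z\in V$ with $|z|^V<\mu$; it has the $\mu$-approximation property if every $x\in W$ with $x\subseteq V$ such that $x\cap z\in V$ for all $z\in V$ with $z\subseteq V$, $|z|^V<\mu$, belongs to $V$. *)

(* Defs.v *)
(* The ambient universe.  A transitive model is a transitive class of a
   well-founded extensional membership structure; no further closure of the
   ambient structure is assumed. *)
Record set_universe := SetUniverse {
  carrier :> Type;
  mem : carrier -> carrier -> Prop;
  mem_ext : forall x y : carrier, (forall z, mem z x <-> mem z y) -> x = y;
  mem_wf : well_founded mem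
}.
Arguments mem {_} _ _.

Declare Scope set_scope.
Delimit Scope set_scope with set.
Open Scope set_scope.
Notation "x ∈ y" := (mem x y) (at level 70, no associativity) : set_scope.
Notation "x ∉ y" := (~ mem x y) (at level 70, no associativity) : set_scope.

Definition class (U : set_universe) := U -> Prop.

Definition class_incl {U : set_universe} (V W : class U) : Prop :=
  forall x, V x -> W x.

Definition transitive_class {U : set_universe} (M : class U) : Prop :=
  forall x y, M x -> y ∈ x -> M y.

Definition subset_class {U : set_universe} (x : U) (M : class U) : Prop :=
  forall y, y ∈ x -> M y.

(* Formulas of the language of set theory, with de Bruijn indices; needed for
   the Separation and Replacement schemas, which must range over first-order
   formulas only and not over arbitrary predicates. *)
Inductive formula : Type :=
| FMem (i j : nat)
| FEq (i j : nat)
| FFalse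
| FImp (f g : formula)
| FAll (f : formula).

Definition env_cons {T : Type} (x : T) (e : nat -> T) (n : nat) : T :=
  match n with O => x | S m => e m end.

Fixpoint sat {U : set_universe} (M : class U) (f : formula) (e : nat -> U)
  : Prop :=
  match f with
  | FMem i j => e i ∈ e j
  | FEq i j => e i = e j
  | FFalse => False
  | FImp g h => sat M g e -> sat M h e
  | FAll g => forall x, M x -> sat M g (env_cons x e)
  end.

(* Everything in this section is relativized to the class [M]: the quantifiers
   ∀, ∃, ∃! range over [M]. *)
Section Relativized.

Context {U : set_universe} (M : class U).

Definition all_in (P : U -> Prop) : Prop := forall x, M x -> P x.
Definition ex_in (P : U -> Prop) : Prop := exists x, M x /\ P x.
Definition ex_unique_in (P : U -> Prop) : Prop :=
  exists x, M x /\ P x /\ forall y, M y -> P y -> y = x.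

Local Notation "∀ x .. y , P" :=
  (all_in (fun x => .. (all_in (fun y => P)) ..))
  (at level 200, x binder, y binder, right associativity).
Local Notation "∃ x .. y , P" :=
  (ex_in (fun x => .. (ex_in (fun y => P)) ..))
  (at level 200, x binder, y binder, right associativity).
Local Notation "∃! x , P" := (ex_unique_in (fun x => P))
  (at level 200, x binder, right associativity).

Definition subset (x y : U) : Prop := ∀ z, z ∈ x -> z ∈ y.

Record ZFC : Prop := {
  zfc_extensionality : ∀ x y, (∀ z, z ∈ x <-> z ∈ y) -> x = y;
  zfc_foundation :
    ∀ x, (∃ y, y ∈ x) -> ∃ y, y ∈ x /\ ∀ z, z ∈ y -> z ∉ x;
  zfc_pairing : ∀ x y, ∃ p, ∀ z, z ∈ p <-> z = x \/ z = y;
  zfc_union : ∀ x, ∃ u, ∀ z, z ∈ u <-> ∃ y, y ∈ x /\ z ∈ y;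
  zfc_powerset : ∀ x, ∃ p, ∀ y, y ∈ p <-> subset y x;
  zfc_infinity :
    ∃ x, (∃ e, e ∈ x /\ ∀ z, z ∉ e) /\
      ∀ y, y ∈ x -> ∃ s, s ∈ x /\ ∀ z, z ∈ s <-> z ∈ y \/ z = y;
  zfc_choice :
    ∀ x, (∀ y, y ∈ x -> ∃ z, z ∈ y) ->
      (∀ y y', y ∈ x -> y' ∈ x -> (∃ z, z ∈ y /\ z ∈ y') -> y = y') ->
      ∃ c, ∀ y, y ∈ x -> ∃! z, z ∈ y /\ z ∈ c;
  zfc_separation :
    forall (f : formula) (e : nat -> U), (forall n, M (e n)) ->
      ∀ x, ∃ s, ∀ z, z ∈ s <-> z ∈ x /\ sat M f (env_cons z e);
  zfc_replacement :
    forall (f : formula) (e : nat -> U), (forall n, M (e n)) ->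
      ∀ x,
        (∀ u v v', u ∈ x ->
           sat M f (env_cons u (env_cons v e)) ->
           sat M f (env_cons u (env_cons v' e)) -> v = v') ->
        ∃ s, ∀ v, v ∈ s <->
          ∃ u, u ∈ x /\ sat M f (env_cons u (env_cons v e))
}.

Definition is_inter (c x y : U) : Prop := ∀ z, z ∈ c <-> z ∈ x /\ z ∈ y.

(* [p] is the Kuratowski pair {{a},{a,b}}. *)
Definition is_pair (p a b : U) : Prop :=
  ∀ z, z ∈ p <-> (∀ w, w ∈ z <-> w = a) \/ (∀ w, w ∈ z <-> w = a \/ w = b).

(* The value of the function [f] at [x] is [y]. *)
Definition maps_to (f x y : U) : Prop := ∃ p, is_pair p x y /\ p ∈ f.

Definition function_on (f : U) (X : class U) : Prop :=
  (∀ p, p ∈ f -> ∃ x y, X x /\ is_pair p x y) /\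
  (∀ x, X x -> ∃! y, maps_to f x y).

Definition bijection (f x y : U) : Prop :=
  function_on f (fun u => u ∈ x) /\
  (∀ u v, maps_to f u v -> v ∈ y) /\
  (∀ v, v ∈ y -> ∃! u, maps_to f u v).

Definition equinumerous (x y : U) : Prop := ∃ f, bijection f x y.

(* Under Foundation, linearly ordered by ∈ is well-ordered by ∈. *)
Definition ordinal (α : U) : Prop :=
  (∀ x, x ∈ α -> subset x α) /\
  (∀ x y, x ∈ α -> y ∈ α -> x ∈ y \/ x = y \/ y ∈ x).

Definition cardinal (κ : U) : Prop :=
  ordinal κ /\ ∀ α, α ∈ κ -> ~ equinumerous α κ.

Definition cardinality (x κ : U) : Prop := cardinal κ /\ equinumerous x κ.

(* |x| < κ; [κ] may be any ordinal. *)
Definition card_lt (x κ : U) : Prop := ∃ μ, cardinality x μ /\ μ ∈ κ.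

Definition limit_ordinal (α : U) : Prop :=
  ordinal α /\ (∃ β, β ∈ α) /\ ∀ β, β ∈ α -> ∃ γ, γ ∈ α /\ β ∈ γ.

Definition is_omega (w : U) : Prop :=
  limit_ordinal w /\ ∀ β, β ∈ w -> ~ limit_ordinal β.

Definition regular (κ : U) : Prop :=
  limit_ordinal κ /\
  ∀ α f, α ∈ κ -> function_on f (fun ξ => ξ ∈ α) ->
    (∀ ξ η, maps_to f ξ η -> η ∈ κ) ->
    ∃ β, β ∈ κ /\ ∀ ξ η, maps_to f ξ η -> η ∈ β.

Definition strong_limit (κ : U) : Prop :=
  ∀ α, α ∈ κ -> ∃ p, (∀ x, x ∈ p <-> subset x α) /\ card_lt p κ.

Definition inaccessible (κ : U) : Prop :=
  cardinal κ /\ (∃ w, is_omega w /\ w ∈ κ) /\ regular κ /\ strong_limit κ.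

(* [Pset κ λ] is P_κ λ as computed in [M]. *)
Definition Pset (κ λ : U) : class U :=
  fun a => M a /\ subset a λ /\ card_lt a κ.

Definition unbounded (κ λ C : U) : Prop :=
  ∀ a, Pset κ λ a -> ∃ c, c ∈ C /\ subset a c.

(* Closed under unions of ⊆-increasing sequences of nonzero length < κ. *)
Definition closed (κ C : U) : Prop :=
  ∀ δ s u, δ ∈ κ -> (∃ ξ, ξ ∈ δ) ->
    function_on s (fun ξ => ξ ∈ δ) ->
    (∀ ξ x, maps_to s ξ x -> x ∈ C) ->
    (∀ ξ η x y, maps_to s ξ x -> maps_to s η y -> ξ ∈ η -> subset x y) ->
    (∀ z, z ∈ u <-> ∃ ξ x, maps_to s ξ x /\ z ∈ x) ->
    u ∈ C.

Definition club (κ λ C : U) : Prop :=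
  subset_class C (Pset κ λ) /\ unbounded κ λ C /\ closed κ C.

Definition stationary (κ λ S : U) : Prop :=
  subset_class S (Pset κ λ) /\
  ∀ C, club κ λ C -> ∃ a, a ∈ S /\ a ∈ C.

(* A P_κ λ-list ⟨d_a⟩ is a set function D; [maps_to D a d] says d_a = d. *)
Definition Plist (κ λ D : U) : Prop :=
  function_on D (Pset κ λ) /\ ∀ a d, maps_to D a d -> subset d a.

Definition thin (κ λ D : U) : Prop :=
  ∃ C, club κ λ C /\
    ∀ c, c ∈ C ->
      ∃ X, (∀ x, x ∈ X <->
              ∃ a d, Pset κ λ a /\ subset c a /\ maps_to D a d /\
                     is_inter x d c) /\
           card_lt X κ.

Definition ineffable_branch (κ λ D d : U) : Prop :=
  subset d λ /\
  ∃ S, stationary κ λ S /\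
    ∀ a da, a ∈ S -> maps_to D a da -> is_inter da d a.

Definition ITP (κ λ : U) : Prop :=
  ∀ D, Plist κ λ D -> thin κ λ D -> ∃ d, ineffable_branch κ λ D d.

Definition effable (κ λ A D : U) : Prop :=
  ∀ S, subset S A -> stationary κ λ S ->
    ∃ a b da db, a ∈ S /\ b ∈ S /\ subset a b /\
      maps_to D a da /\ maps_to D b db /\ ~ is_inter da db a.

Definition I_IT (κ λ : U) : class U :=
  fun A => M A /\ subset_class A (Pset κ λ) /\
    ∃ D, Plist κ λ D /\ thin κ λ D /\ effable κ λ A D.

Definition F_IT (κ λ : U) : class U :=
  fun A => M A /\ subset_class A (Pset κ λ) /\
    ∃ B, (∀ a, a ∈ B <-> Pset κ λ a /\ a ∉ A) /\ I_IT κ λ B.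

End Relativized.

Definition transitive_ZFC_model {U : set_universe} (M : class U) : Prop :=
  transitive_class M /\ ZFC M.

Definition covering_property {U : set_universe} (V W : class U) (μ : U)
  : Prop :=
  forall x, W x -> subset_class x V -> card_lt W x μ ->
    exists z, V z /\ card_lt V z μ /\ subset W x z.

Definition approximation_property {U : set_universe} (V W : class U) (μ : U)
  : Prop :=
  forall x, W x -> subset_class x V ->
    (forall z, V z -> subset_class z V -> card_lt V z μ ->
       exists y, V y /\ is_inter W y x z) ->
    V x.

(* Main.v *)
From Stdlib Require Import Classical ClassicalEpsilon.
From Corelib Require Import ssreflect.
Require Import Defs.

Set Bullet Behavior "None".

(** Since [κ] is inaccessible in [V] and [(V, W)] has [κ]-covering, every list
    of [W] whose entries are of the form [a ∩ y] with [y ∈ V] is thin: its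
    traces on [c] are determined by the subsets in [V] of a cover [c' ∈ V] of
    [c].  Given a [B]-effable list [D] of [V], extend it to [P_κ λ] of [W] by
    [a ∩ z_a] for [a ∉ V], where [z_a ∈ V] has size [< τ] and [a ∩ z_a ∉ V];
    such a [z_a] exists by [τ]-approximation.  If this list were coherent on a
    stationary [S], its union [d] would be approximated in [V], hence lie in
    [V].  Either [d] is small, and then [a ∩ z_a = d] for [a ⊇ d], or [d] has a
    small subset [e ∈ V] too large to be contained in any [z_a]; so [S] is
    contained in [V] beyond some [x].  Every club of [V] contains the
    [V]-members of some club of [W] (sets closed under a function on finite
    sets), so [{a ∈ B : D_a = d ∩ a}] is stationary in [V], contradicting
    effability.  The three claims are the cases [B = ∅], [B = P_κ λ \ A] and
    [B = P_κ λ]. *)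

(** * Definable predicates and terms *)

(** Separation and Replacement hold for formulas only, and the models are arbitrary transitive
    classes. Every set built in a model therefore needs a definition over it. Moreover [V] need not
    be definable in [W]: constructions in [W] refer to [V] only through sets taken as parameters,
    such as [PM V κ λ], [pow V λ] or [Fin V λ]. Set terms are evaluated in the ambient structure, so
    that both models share them. Of inaccessibility only regularity is carried over to [W], by
    covering; the strong limit property is used in [V] alone. Functions on finite sets enter because
    a club of [V] says nothing about chains that exist in [W] only, whereas closure under a function
    with finite arguments passes to the union of any chain. The bound [τ ∈ κ] enters through
    [pow V τ], whose size in [V] is below [κ]: by Cantor, a set of [V] into which it injects is
    contained in no set of [V] of size less than [τ]. *)

Section Definability.

Context {U : set_universe} (M : class U).

Definition menv (e : nat -> U) : Prop := forall n, M (e n).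

Fixpoint ren (g : nat -> nat) (f : formula) : formula :=
  match f with
  | FMem i j => FMem (g i) (g j)
  | FEq i j => FEq (g i) (g j)
  | FFalse => FFalse
  | FImp a b => FImp (ren g a) (ren g b)
  | FAll a => FAll (ren (fun n => match n with O => O | S m => S (g m) end) a)
  end.

Lemma sat_ren (f : formula) (g : nat -> nat) (e e' : nat -> U) :
  (forall i, e' i = e (g i)) -> (sat M (ren g f) e <-> sat M f e').
Proof.
elim: f g e e' => [i j|i j||a IHa b IHb|a IHa] g e e' H /=.
- by rewrite !H.
- by rewrite !H.
- by [].
- by rewrite (IHa _ _ _ H) (IHb _ _ _ H).
- split=> Hs x Mx; have := Hs x Mx; apply IHa; by case=> [|i] /=.
Qed.

Definition look (r : nat -> nat + U) (e : nat -> U) (i : nat) : U :=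
  match r i with inl k => e k | inr p => p end.

(* Variable [i] of the formula is interpreted through [r], either by an entry
   of the environment or by a parameter from [M]; keeping the two apart makes
   parameters invisible to the quantifier rules. *)
Definition Def (P : (nat -> U) -> Prop) : Prop :=
  exists f r, (forall i p, r i = inr p -> M p) /\
    forall e, menv e -> (P e <-> sat M f (look r e)).

(** An operation is represented by its graph, with the value in slot 0 and the arguments shifted by
    one. Values in [M] are demanded so that a quantifier over [M] can eliminate the term, as in
    [Def_subst]. *)
Definition DefT (t : (nat -> U) -> U) : Prop :=
  (forall e, menv e -> M (t e)) /\ Def (fun e => e 0 = t (fun n => e (S n))).

Lemma menv_cons (x : U) (e : nat -> U) : M x -> menv e -> menv (env_cons x e).
Proof. by move=> Mx He [|n] //=. Qed.

Lemma Def_ext (P Q : (nat -> U) -> Prop) :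
  (forall e, menv e -> (P e <-> Q e)) -> Def P -> Def Q.
Proof.
move=> H [f [r [Hr Hf]]]; exists f, r; split=> // e He.
by rewrite -(H e He) Hf.
Qed.

(** Classically, what does not depend on the environment is a constant truth value, whatever classes
    it mentions. *)
Lemma Def_prop (Q : Prop) : Def (fun _ => Q).
Proof.
have [q|q] := classic Q.
  exists (FImp FFalse FFalse), inl; split; first by [].
  by move=> e _ /=; split.
exists FFalse, inl; split; first by [].
by move=> e _ /=; split.
Qed.

(** Two formulas come with two assignments of their variables. Even variables are given to one and
    odd variables to the other, so that a single assignment serves both. *)
Fixpoint halve (n : nat) : nat * bool :=
  match n with
  | O => (O, true)
  | S O => (O, false)
  | S (S m) => let '(k, b) := halve m in (S k, b)
  end.

Lemma halve_double (n : nat) :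
  halve (n + n) = (n, true) /\ halve (S (n + n)) = (n, false).
Proof.
elim: n => [|n [IH1 IH2]] //.
have E k : S k + S k = S (S (k + k)) by rewrite /= -plus_n_Sm.
rewrite E -[halve (S (S (n + n)))]/(let '(k, b) := halve (n + n) in (S k, b)).
by rewrite -[halve (S (S _))]/(let '(k, b) := halve (S (n + n)) in (S k, b)) IH1 IH2.
Qed.

Lemma Def_imp (P Q : (nat -> U) -> Prop) :
  Def P -> Def Q -> Def (fun e => P e -> Q e).
Proof.
move=> [f [r [Hr Hf]]] [g [s [Hs Hg]]].
exists (FImp (ren (fun n => n + n) f) (ren (fun n => S (n + n)) g)).
exists (fun n => let '(k, b) := halve n in if b then r k else s k); split.
  by move=> i p; case: (halve i) => k [] /=; [apply: Hr|apply: Hs].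
move=> e He /=.
rewrite (Hf e He) (Hg e He) (sat_ren f _ _ (look r e)).
  by move=> i; rewrite /look (proj1 (halve_double i)).
rewrite (sat_ren g _ _ (look s e)) //.
by move=> i; rewrite /look (proj2 (halve_double i)).
Qed.

(** All variables assigned to slot 0 are merged into the bound variable; the others move up by one
    under the quantifier, while their slots move down by one. Parameters stay as they are. *)
Lemma Def_all (P : U -> (nat -> U) -> Prop) :
  Def (fun e => P (e 0) (fun n => e (S n))) ->
  Def (fun e => forall x, M x -> P x e).
Proof.
move=> [f [r [Hr Hf]]].
exists (FAll (ren (fun i => match r i with inl O => O | _ => S i end) f)).
exists (fun i => match r i with
                 | inl (S k) => inl k | inl O => inl O | inr p => inr p end).
split.
  by move=> i p; case E : (r i) => [[|k]|q] //; case=> <-; apply: Hr E.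
move=> e He /=; split=> H x Mx.
- have := Hf (env_cons x e) (menv_cons x e Mx He); move=> [Hf1 _].
  have {Hf1} := Hf1 (H x Mx).
  apply sat_ren => i; rewrite /look.
  by case E : (r i) => [[|k]|p] //=; rewrite E.
- have [_ Hf2] := Hf (env_cons x e) (menv_cons x e Mx He).
  apply: Hf2; have := H x Mx.
  apply sat_ren => i; rewrite /look.
  by case E : (r i) => [[|k]|p] //=; rewrite E.
Qed.

Lemma Def_not (P : (nat -> U) -> Prop) : Def P -> Def (fun e => ~ P e).
Proof. by move=> HP; apply: Def_imp HP (Def_prop False). Qed.

Lemma Def_and (P Q : (nat -> U) -> Prop) :
  Def P -> Def Q -> Def (fun e => P e /\ Q e).
Proof.
move=> HP HQ; apply: (Def_ext (fun e => ~ (P e -> ~ Q e))).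
  by move=> e _; split; [move=> H; split; apply NNPP; tauto|tauto].
by apply/Def_not/Def_imp => //; apply: Def_not.
Qed.

Lemma Def_or (P Q : (nat -> U) -> Prop) :
  Def P -> Def Q -> Def (fun e => P e \/ Q e).
Proof.
move=> HP HQ; apply: (Def_ext (fun e => ~ P e -> Q e)).
  by move=> e _; split; [case: (classic (P e)); tauto|tauto].
by apply/Def_imp => //; apply: Def_not.
Qed.

Lemma Def_iff (P Q : (nat -> U) -> Prop) :
  Def P -> Def Q -> Def (fun e => P e <-> Q e).
Proof. by move=> HP HQ; apply: Def_and; apply: Def_imp. Qed.

Lemma Def_ex (P : U -> (nat -> U) -> Prop) :
  Def (fun e => P (e 0) (fun n => e (S n))) ->
  Def (fun e => exists x, M x /\ P x e).
Proof.
move=> HP; apply: (Def_ext (fun e => ~ forall x, M x -> ~ P x e)).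
  move=> e _; split.
    move=> H; apply NNPP => H'; apply H => x Mx Px; apply H'; by exists x.
  by move=> [x [Mx Px]] H; apply: H Mx Px.
by apply/Def_not/(Def_all (fun x e => ~ P x e))/Def_not.
Qed.

Lemma Def_subst (P : U -> (nat -> U) -> Prop) (t : (nat -> U) -> U) :
  DefT t -> Def (fun e => P (e 0) (fun n => e (S n))) ->
  Def (fun e => P (t e) e).
Proof.
move=> [Mt Ht] HP.
apply: (Def_ext (fun e => exists x, M x /\ (x = t e /\ P x e))).
  move=> e He; split; first by move=> [x [_ [-> //]]].
  by move=> H; exists (t e); split; first exact: Mt.
by apply: (Def_ex (fun x e => x = t e /\ P x e)); apply: Def_and.
Qed.

Lemma DefT_var (k : nat) : DefT (fun e => e k).
Proof.
split=> //; exists (FEq 0 (S k)), inl; split=> // e He /=.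
Qed.

Lemma DefT_const (p : U) : M p -> DefT (fun _ => p).
Proof.
move=> Mp; split=> //.
exists (FEq 0 1), (fun i => match i with O => inl O | _ => inr p end).
by split; [case=> [|i] q //; case=> <-|].
Qed.

(** Only the assignment of variables to slots changes, not the formula. *)
Lemma Def_ren (h : nat -> nat) (P : (nat -> U) -> Prop) :
  Def P -> Def (fun e => P (fun n => e (h n))).
Proof.
move=> [f [r [Hr Hf]]].
exists (ren (fun i => i) f).
exists (fun i => match r i with inl k => inl (h k) | inr p => inr p end).
split; first by move=> i p; case E : (r i) => [k|q] //; case=> <-; apply: Hr E.
move=> e He; rewrite (Hf (fun n => e (h n))); first by move=> n; apply: He.
by symmetry; apply: sat_ren => i; rewrite /look; case: (r i).
Qed.

Lemma DefT_ren (h : nat -> nat) (t : (nat -> U) -> U) :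
  DefT t -> DefT (fun e => t (fun n => e (h n))).
Proof.
move=> [Mt Ht]; split; first by move=> e He; apply: Mt => n; apply: He.
exact: (Def_ren (fun n => match n with O => O | S k => S (h k) end) _ Ht).
Qed.

Lemma Def_mem (s t : (nat -> U) -> U) :
  DefT s -> DefT t -> Def (fun e => s e ∈ t e).
Proof.
move=> Hs Ht; apply: (Def_subst (fun x e => x ∈ t e)) => //.
apply: (Def_subst (fun y e => e 0 ∈ y)); first exact: (DefT_ren S).
by exists (FMem 1 0), inl.
Qed.

Lemma Def_eq (s t : (nat -> U) -> U) :
  DefT s -> DefT t -> Def (fun e => s e = t e).
Proof.
move=> Hs Ht; apply: (Def_subst (fun x e => x = t e)) => //.
by case: Ht.
Qed.

End Definability.

(** Chosen by epsilon, so that set terms are total although the ambient structure has no closure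
    properties. By extensionality the value is unique as soon as such a set exists in some model;
    hence it does not depend on the model. *)
Definition setof {U : set_universe} (x0 : U) (P : U -> Prop) : U :=
  epsilon (inhabits x0) (fun s => forall z, z ∈ s <-> P z).

Section Terms.

Context {U : set_universe}.
Implicit Types (x y z a b f p s : U) (P : U -> Prop) (t : U -> U).

Definition sub x y : Prop := forall z, z ∈ x -> z ∈ y.
Definition is_upair s a b : Prop := forall z, z ∈ s <-> z = a \/ z = b.
(** A relation, because the ambient structure need not contain pairs; it lets [app] be defined
    without reference to a model. *)
Definition is_opair p a b : Prop :=
  exists s r, is_upair s a a /\ is_upair r a b /\ is_upair p s r.
Definition upair a b : U := setof a (fun z => z = a \/ z = b).
Definition pr a b : U := upair (upair a a) (upair a b).
Definition Un x : U := setof x (fun z => exists y, y ∈ x /\ z ∈ y).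
Definition sep x P : U := setof x (fun z => z ∈ x /\ P z).
Definition img x t : U := setof x (fun z => exists w, w ∈ x /\ z = t w).
(* Total: the union of all values of [f] at [x], so [∅] outside the domain. *)
Definition app f x : U :=
  setof f (fun z => exists p, p ∈ f /\ exists y, is_opair p x y /\ z ∈ y).
Definition lam x t : U := img x (fun z => pr z (t z)).
Definition cap x y : U := sep x (fun z => z ∈ y).
Definition cup x y : U := Un (upair x y).
Definition empty x : U := sep x (fun _ => False).
Definition pow (M : class U) x : U := setof x (fun y => M y /\ sub y x).

Lemma set_ext x y : (forall z, z ∈ x <-> z ∈ y) -> x = y.
Proof. exact: mem_ext. Qed.

Lemma sub_antisym x y : sub x y -> sub y x -> x = y.
Proof. by move=> H1 H2; apply: set_ext => z; split; auto. Qed.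

Lemma setof_spec x0 P s :
  (forall z, z ∈ s <-> P z) -> setof x0 P = s.
Proof.
move=> Hs; apply: set_ext => z; rewrite Hs.
by apply: (epsilon_spec (inhabits x0) (fun s => forall z, z ∈ s <-> P z)); exists s.
Qed.

Lemma is_opair_inj p a b a' b' :
  is_opair p a b -> is_opair p a' b' -> a = a' /\ b = b'.
Proof.
move=> [s [t [Hs [Ht Hp]]]] [s' [t' [Hs' [Ht' Hp']]]].
have Ea : a = a'.
  have : s ∈ p by apply Hp; left.
  have as_ : a ∈ s by apply Hs; left.
  have at_ : a ∈ t by apply Ht; left.
  move/Hp' => [E|E]; rewrite E in as_ Hs.
    by apply Hs' in as_; tauto.
  have : a' ∈ t' by apply Ht'; left.
  by move/Hs; case.
subst a'; split=> //.
have ss : s = s' by apply: set_ext => z; rewrite (Hs z) (Hs' z).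
subst s'.
have : t ∈ p by apply Hp; right.
have : t' ∈ p by apply Hp'; right.
have bt : b ∈ t by apply Ht; right.
have bt' : b' ∈ t' by apply Ht'; right.
move/Hp => H1 /Hp' H2.
case: H2 => E2; last by subst t'; apply Ht in bt'; apply Ht' in bt; intuition congruence.
subst t; apply Hs in bt.
case: H1 => E1; subst t'; apply Hs in bt'; intuition congruence.
Qed.

End Terms.

(** * Closure of transitive models *)

Section Closure.

Context {U : set_universe} {M : class U} (HM : transitive_ZFC_model M).

Lemma model_trans (x y : U) : M x -> y ∈ x -> M y.
Proof. by case: HM => H _; apply: H. Qed.

(** Every slot but the first is frozen into a parameter, which yields the predicates of one variable
    to which [sep_model] applies. *)
Lemma Def_inst (P : U -> (nat -> U) -> Prop) (e0 : nat -> U) :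
  menv M e0 -> Def M (fun e => P (e 0) (fun n => e (S n))) ->
  Def M (fun e => P (e 0) e0).
Proof.
move=> He0 [f [r [Hr Hf]]].
exists (ren (fun i => i) f).
exists (fun i => match r i with
         | inl O => inl O | inl (S k) => inr (e0 k) | inr p => inr p end).
split.
  move=> i p; case E : (r i) => [[|k]|q] //; case=> <-; first exact: He0.
  exact: Hr E.
move=> e He.
have := Hf _ (menv_cons M (e 0) e0 (He 0) He0); rewrite /= => ->.
by symmetry; apply: sat_ren => i; rewrite /look; case: (r i) => [[|k]|p].
Qed.

Lemma Def_ball (P : U -> (nat -> U) -> Prop) (t : (nat -> U) -> U) :
  DefT M t -> Def M (fun e => P (e 0) (fun n => e (S n))) ->
  Def M (fun e => forall z, z ∈ t e -> P z e).
Proof.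
move=> Ht HP.
apply: (Def_ext M (fun e => forall z, M z -> z ∈ t e -> P z e)).
  move=> e He; split=> H z.
    by move=> zt; apply: H => //; apply: model_trans zt; apply Ht.
  by move=> _; apply: H.
apply: (Def_all M (fun z e => z ∈ t e -> P z e)).
apply: Def_imp => //; apply: Def_mem; first exact: DefT_var.
exact: (DefT_ren M S).
Qed.

Lemma Def_ball2 (P : U -> U -> (nat -> U) -> Prop) (s t : (nat -> U) -> U) :
  DefT M s -> DefT M t ->
  Def M (fun e => P (e 1) (e 0) (fun n => e (S (S n)))) ->
  Def M (fun e => forall y z, y ∈ s e -> z ∈ t e -> P y z e).
Proof.
move=> Hs Ht HP.
apply: (Def_ext M (fun e => forall y, y ∈ s e -> forall z, z ∈ t e -> P y z e)).
  by move=> e He; split=> H y; [move=> z ys|move=> ys z]; apply: H.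
apply: (Def_ball (fun y e => forall z, z ∈ t e -> P y z e)) => //.
by apply: (Def_ball (fun z e => P (e 0) z (fun n => e (S n)))) => //; apply: (DefT_ren M S).
Qed.

Lemma Def_bex (P : U -> (nat -> U) -> Prop) (t : (nat -> U) -> U) :
  DefT M t -> Def M (fun e => P (e 0) (fun n => e (S n))) ->
  Def M (fun e => exists z, z ∈ t e /\ P z e).
Proof.
move=> Ht HP.
apply: (Def_ext M (fun e => exists z, M z /\ (z ∈ t e /\ P z e))).
  move=> e He; split; first by move=> [z [_ H]]; exists z.
  move=> [z [zt Pz]]; exists z; split=> //.
  by apply: model_trans zt; apply Ht.
apply: (Def_ex M (fun z e => z ∈ t e /\ P z e)).
apply: Def_and => //; apply: Def_mem; first exact: DefT_var.
exact: (DefT_ren M S).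
Qed.

(** Since [P] sees slot 0 only, it may be evaluated in the constant environment [z]. All
    non-parameter variables can thus be renamed to 0, and the parameters fill the environment
    required by Separation. *)
Lemma sep_model (x : U) (P : U -> Prop) :
  M x -> Def M (fun e => P (e 0)) ->
  exists s, M s /\ forall z, z ∈ s <-> z ∈ x /\ P z.
Proof.
move=> Mx [f [r [Hr Hf]]].
pose e i := match r i with inr p => p | inl _ => x end.
have Me n : M (e n) by rewrite /e; case E : (r n) => [k|p] //; apply: Hr E.
pose g i := match r i with inl _ => O | inr _ => S i end.
have [_ [_ _ _ _ _ _ _ Hsep _]] := HM.
have [s [Ms Hs]] := Hsep (ren g f) e Me x Mx.
exists s; split=> // z.
have key : M z -> (z ∈ s <-> z ∈ x /\ P z).
  move=> Mz; rewrite (Hs z Mz) (Hf (fun _ => z)) //.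
  rewrite (sat_ren M f g _ (look r (fun _ => z))) //.
  by move=> i; rewrite /look /g; case E : (r i) => [k|p] //=; rewrite /e E.
split=> H; first by apply key => //; apply: model_trans H.
by apply key => //; case: H => H _; apply: model_trans H.
Qed.

(** As in [sep_model], but with two variables: the value slot becomes variable 1, every other slot
    becomes variable 0, and the parameters follow. *)
Lemma img_model (x : U) (t : U -> U) :
  M x -> DefT M (fun e => t (e 0)) ->
  exists s, M s /\ forall z, z ∈ s <-> exists w, w ∈ x /\ z = t w.
Proof.
move=> Mx [Mt [f [r [Hr Hf]]]].
pose e i := match r i with inr p => p | inl _ => x end.
have Me n : M (e n) by rewrite /e; case E : (r n) => [k|p] //; apply: Hr E.
pose g i := match r i with inl O => 1 | inl _ => O | inr _ => S (S i) end.
have {}Mt w : M w -> M (t w) by move=> Mw; apply: (Mt (fun _ => w)).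
have key u v : M u -> M v ->
    (sat M (ren g f) (env_cons u (env_cons v e)) <-> v = t u).
  move=> Mu Mv.
  rewrite (Hf (env_cons v (fun _ => u))); first by case.
  rewrite (sat_ren M f g _ (look r (env_cons v (fun _ => u)))) //.
  by move=> i; rewrite /look /g; case E : (r i) => [[|k]|p] //=; rewrite /e E.
have [_ [_ _ _ _ _ _ _ _ Hrep]] := HM.
have [] := Hrep (ren g f) e Me x Mx.
  by move=> u Mu v Mv v' Mv' _ /(key u v Mu Mv) -> /(key u v' Mu Mv') ->.
move=> s [Ms Hs]; exists s; split=> // z; split.
  move=> zs; have Mz := model_trans _ _ Ms zs.
  move/(Hs z Mz): zs => [w [Mw [wx /(key w z Mw Mz) E]]].
  by exists w.
move=> [w [wx E]]; have Mw := model_trans _ _ Mx wx.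
have Mz : M z by rewrite E; apply: Mt.
by apply/(Hs z Mz); exists w; split=> //; split=> //; apply/key.
Qed.

Lemma upair_model (a b : U) : M a -> M b ->
  exists s, M s /\ forall z, z ∈ s <-> z = a \/ z = b.
Proof.
move=> Ma Mb; have [_ [_ _ H _ _ _ _ _ _]] := HM.
have [p [Mp Hp]] := H a Ma b Mb; exists p; split=> // z; split.
  by move=> zp; apply/Hp => //; apply: model_trans zp.
by move=> [->|->]; apply/Hp => //; [left|right].
Qed.

Lemma Un_model (x : U) : M x ->
  exists s, M s /\ forall z, z ∈ s <-> exists y, y ∈ x /\ z ∈ y.
Proof.
move=> Mx; have [_ [_ _ _ H _ _ _ _ _]] := HM.
have [u [Mu Hu]] := H x Mx; exists u; split=> // z; split.
  move=> zu; have Mz := model_trans _ _ Mu zu.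
  by move/(Hu z Mz): zu => [y [_ ?]]; exists y.
move=> [y [yx zy]]; have My := model_trans _ _ Mx yx.
apply/Hu; first exact: model_trans zy.
by exists y.
Qed.

Lemma pow_model (x : U) : M x ->
  exists s, M s /\ forall y, y ∈ s <-> M y /\ sub y x.
Proof.
move=> Mx; have [_ [_ _ _ _ H _ _ _ _]] := HM.
have [u [Mu Hu]] := H x Mx; exists u; split=> // y; split.
  move=> yu; have My := model_trans _ _ Mu yu; split=> // z zy.
  by move/(Hu y My): yu; apply=> //; apply: model_trans zy.
by move=> [My yx]; apply/Hu => // z _; apply: yx.
Qed.

(** The graph is given by extensionality: the value is the set with the right members in [M], and by
    transitivity it has no others. *)
Lemma DefT_setof (x0 : (nat -> U) -> U) (P : U -> (nat -> U) -> Prop) :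
  (forall e, menv M e -> exists s, M s /\ forall z, z ∈ s <-> P z e) ->
  Def M (fun e => P (e 0) (fun n => e (S n))) ->
  DefT M (fun e => setof (x0 e) (fun z => P z e)).
Proof.
move=> Hs HP.
have key e : menv M e -> M (setof (x0 e) (fun z => P z e)) /\
    forall z, z ∈ setof (x0 e) (fun z => P z e) <-> P z e.
  by move=> /Hs [s [Ms Es]]; rewrite (setof_spec _ _ _ Es).
split; first by move=> e /key [].
apply: (Def_ext M (fun e => forall z, M z -> (z ∈ e 0 <-> P z (fun n => e (S n))))).
  move=> e He; have He' : menv M (fun n => e (S n)) by move=> n; apply: He.
  have [K1 K2] := key _ He'; split.
    move=> H; apply: set_ext => z; split=> Hz.
      by apply K2; apply H => //; apply: model_trans Hz.
    by apply H; [apply: model_trans Hz|apply K2].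
  by move=> -> z _; apply: K2.
apply: (Def_all M (fun z e => z ∈ e 0 <-> P z (fun n => e (S n)))).
apply: Def_iff; first by apply: Def_mem; apply: DefT_var.
exact: (Def_ren M (fun n => match n with O => O | S k => S (S k) end) _ HP).
Qed.

Lemma DefT_sep (t : (nat -> U) -> U) (P : U -> (nat -> U) -> Prop) :
  DefT M t -> Def M (fun e => P (e 0) (fun n => e (S n))) ->
  DefT M (fun e => sep (t e) (fun z => P z e)).
Proof.
move=> Ht HP; apply: (DefT_setof t (fun z e => z ∈ t e /\ P z e)).
  by move=> e He; apply: sep_model; [apply Ht|apply: Def_inst He HP].
apply: Def_and => //; apply: Def_mem; first exact: DefT_var.
exact: (DefT_ren M S).
Qed.

Lemma DefT_inst (t : U -> (nat -> U) -> U) (e0 : nat -> U) :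
  menv M e0 -> DefT M (fun e => t (e 0) (fun n => e (S n))) ->
  DefT M (fun e => t (e 0) e0).
Proof.
move=> He0 [Mt [f [r [Hr Hf]]]]; split.
  by move=> e He; apply: (Mt (env_cons (e 0) e0)); apply: menv_cons.
exists (ren (fun i => i) f).
exists (fun i => match r i with
         | inl O => inl O | inl (S O) => inl (S O)
         | inl (S (S k)) => inr (e0 k) | inr p => inr p end).
split.
  move=> i p; case E : (r i) => [[|[|k]]|q] //; case=> <-; first exact: He0.
  exact: Hr E.
move=> e He.
have := Hf (env_cons (e 0) (env_cons (e 1) e0)) _; rewrite /= => ->.
  by apply: menv_cons => //; apply: menv_cons.
by symmetry; apply: sat_ren => i; rewrite /look; case: (r i) => [[|[|k]]|p].
Qed.

Lemma DefT_img (x : (nat -> U) -> U) (t : U -> (nat -> U) -> U) :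
  DefT M x -> DefT M (fun e => t (e 0) (fun n => e (S n))) ->
  DefT M (fun e => img (x e) (fun w => t w e)).
Proof.
move=> Hx Ht; apply: (DefT_setof x (fun z e => exists w, w ∈ x e /\ z = t w e)).
  by move=> e He; apply: img_model; [apply Hx|apply: DefT_inst He Ht].
apply: (Def_bex (fun w e => e 0 = t w (fun n => e (S n)))).
  exact: (DefT_ren M S).
apply: Def_eq; first exact: DefT_var.
exact: (DefT_ren M (fun n => match n with O => O | S k => S (S k) end) _ Ht).
Qed.

Lemma DefT_upair (s t : (nat -> U) -> U) :
  DefT M s -> DefT M t -> DefT M (fun e => upair (s e) (t e)).
Proof.
move=> Hs Ht; apply: (DefT_setof s (fun z e => z = s e \/ z = t e)).
  by move=> e He; apply: upair_model; [apply Hs|apply Ht].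
by apply: Def_or; apply: Def_eq; try exact: DefT_var; apply: (DefT_ren M S).
Qed.

Lemma DefT_pr (s t : (nat -> U) -> U) :
  DefT M s -> DefT M t -> DefT M (fun e => pr (s e) (t e)).
Proof. by move=> Hs Ht; apply: DefT_upair; apply: DefT_upair. Qed.

Lemma DefT_Un (t : (nat -> U) -> U) :
  DefT M t -> DefT M (fun e => Un (t e)).
Proof.
move=> Ht; apply: (DefT_setof t (fun z e => exists y, y ∈ t e /\ z ∈ y)).
  by move=> e He; apply: Un_model; apply Ht.
apply: (Def_bex (fun y e => e 0 ∈ y)); first exact: (DefT_ren M S).
by apply: Def_mem; apply: DefT_var.
Qed.

Lemma DefT_cup (s t : (nat -> U) -> U) :
  DefT M s -> DefT M t -> DefT M (fun e => cup (s e) (t e)).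
Proof. by move=> Hs Ht; apply: DefT_Un; apply: DefT_upair. Qed.

Lemma DefT_cap (s t : (nat -> U) -> U) :
  DefT M s -> DefT M t -> DefT M (fun e => cap (s e) (t e)).
Proof.
move=> Hs Ht; apply: (DefT_sep s (fun z e => z ∈ t e)) => //.
by apply: Def_mem; [apply: DefT_var|apply: (DefT_ren M S)].
Qed.

Lemma DefT_empty (t : (nat -> U) -> U) :
  DefT M t -> DefT M (fun e => empty (t e)).
Proof. by move=> Ht; apply: (DefT_sep t (fun z e => False)) => //; apply: Def_prop. Qed.

Lemma DefT_lam (x : (nat -> U) -> U) (t : U -> (nat -> U) -> U) :
  DefT M x -> DefT M (fun e => t (e 0) (fun n => e (S n))) ->
  DefT M (fun e => lam (x e) (fun w => t w e)).
Proof.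
move=> Hx Ht; apply: (DefT_img x (fun w e => pr w (t w e))) => //.
by apply: DefT_pr => //; apply: DefT_var.
Qed.

Lemma in_upair (a b z : U) : M a -> M b -> (z ∈ upair a b <-> z = a \/ z = b).
Proof.
by move=> Ma Mb; have [s [_ Hs]] := upair_model a b Ma Mb; rewrite /upair (setof_spec _ _ _ Hs).
Qed.

Lemma in_Un (x z : U) : M x -> (z ∈ Un x <-> exists y, y ∈ x /\ z ∈ y).
Proof.
by move=> Mx; have [s [_ Hs]] := Un_model x Mx; rewrite /Un (setof_spec _ _ _ Hs).
Qed.

Lemma in_pow (x z : U) : M x -> (z ∈ pow M x <-> M z /\ sub z x).
Proof.
by move=> Mx; have [s [_ Hs]] := pow_model x Mx; rewrite /pow (setof_spec _ _ _ Hs).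
Qed.

Lemma pow_closed (x : U) : M x -> M (pow M x).
Proof.
by move=> Mx; have [s [? Hs]] := pow_model x Mx; rewrite /pow (setof_spec _ _ _ Hs).
Qed.

Lemma in_sep (x z : U) (P : U -> Prop) :
  M x -> Def M (fun e => P (e 0)) -> (z ∈ sep x P <-> z ∈ x /\ P z).
Proof.
by move=> Mx HP; have [s [_ Hs]] := sep_model x P Mx HP; rewrite /sep (setof_spec _ _ _ Hs).
Qed.

Lemma in_img (x z : U) (t : U -> U) :
  M x -> DefT M (fun e => t (e 0)) ->
  (z ∈ img x t <-> exists w, w ∈ x /\ z = t w).
Proof.
by move=> Mx Ht; have [s [_ Hs]] := img_model x t Mx Ht; rewrite /img (setof_spec _ _ _ Hs).
Qed.

Lemma in_cap (x y z : U) : M x -> M y -> (z ∈ cap x y <-> z ∈ x /\ z ∈ y).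
Proof.
move=> Mx My; rewrite /cap in_sep //.
by apply: Def_mem; [apply: DefT_var|apply: DefT_const].
Qed.

(** Closure of [M] under a term is definability without variables, so one syntax-directed tactic
    proves both. Infinity supplies an element of [M] with which to form an environment. *)
Lemma DefT_closed (p : U) : DefT M (fun _ => p) -> M p.
Proof.
move=> [H _]; have [_ [_ _ _ _ _ [x [Mx _]] _ _ _]] := HM.
exact: (H (fun _ => x)).
Qed.

Lemma upair_closed (a b : U) : M a -> M b -> M (upair a b).
Proof. by move=> ? ?; apply/DefT_closed/DefT_upair; apply: DefT_const. Qed.

Lemma pr_closed (a b : U) : M a -> M b -> M (pr a b).
Proof. by move=> ? ?; apply/DefT_closed/DefT_pr; apply: DefT_const. Qed.

Lemma Un_closed (x : U) : M x -> M (Un x).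
Proof. by move=> ?; apply/DefT_closed/DefT_Un; apply: DefT_const. Qed.

Lemma in_cup (x y z : U) : M x -> M y -> (z ∈ cup x y <-> z ∈ x \/ z ∈ y).
Proof.
move=> Mx My; rewrite /cup in_Un; first exact: upair_closed.
split.
  by move=> [w []]; rewrite in_upair // => -[->|->]; [left|right].
by case=> ?; [exists x|exists y]; rewrite in_upair //; tauto.
Qed.

Lemma in_empty (x z : U) : M x -> ~ z ∈ empty x.
Proof. by move=> Mx; rewrite /empty in_sep //; [apply: Def_prop|case]. Qed.

Lemma is_opair_pr (p a b : U) : M a -> M b -> (is_opair p a b <-> p = pr a b).
Proof.
move=> Ma Mb.
have H c d : M c -> M d -> forall s, is_upair s c d <-> s = upair c d.
  move=> Mc Md s; split.
    by move=> Hs; apply: set_ext => z; rewrite in_upair // Hs.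
  by move=> -> z; rewrite in_upair.
have M1 := upair_closed a a Ma Ma; have M2 := upair_closed a b Ma Mb.
split.
  move=> [s [t []]]; rewrite H // => -> []; rewrite H // => ->.
  by rewrite H.
by move=> ->; exists (upair a a), (upair a b); rewrite !H.
Qed.

Lemma pr_inj (a b a' b' : U) : M a -> M b -> M a' -> M b' ->
  pr a b = pr a' b' -> a = a' /\ b = b'.
Proof.
move=> *; apply: (is_opair_inj (pr a b)); by apply/is_opair_pr.
Qed.

Lemma is_opair_model (p a b : U) : M p -> is_opair p a b -> M a /\ M b.
Proof.
move=> Mp [s [t [Hs [Ht Hp]]]].
have Mt : M t by apply: model_trans Mp _; apply Hp; right.
by split; apply: model_trans Mt _; apply Ht; [left|right].
Qed.

Lemma app_model (f x : U) : M f -> M x ->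
  exists s, M s /\ forall z, z ∈ s <->
    exists p, p ∈ f /\ exists y, is_opair p x y /\ z ∈ y.
Proof.
move=> Mf Mx.
(* Three unions suffice: [z] is in [y], which is in [upair x y], which is in [pr x y], which is in
   [f]. *)
have [s [Ms Hs]] := sep_model (Un (Un (Un f)))
  (fun z => exists y, M y /\ (pr x y ∈ f /\ z ∈ y))
  (Un_closed _ (Un_closed _ (Un_closed _ Mf))) ltac:(
  apply: (Def_ex M (fun y e => pr x y ∈ f /\ e 0 ∈ y));
  apply: Def_and; apply: Def_mem; try exact: DefT_var; try exact: DefT_const;
  apply: DefT_pr; try exact: DefT_var; try exact: DefT_const).
exists s; split=> // z; rewrite Hs; split.
  move=> [_ [y [My [Hf zy]]]]; exists (pr x y); split=> //.
  by exists y; split=> //; apply/is_opair_pr.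
move=> [p [pf [y [Hp zy]]]].
have Mp := model_trans _ _ Mf pf.
have [_ My] := is_opair_model _ _ _ Mp Hp.
move/(is_opair_pr _ _ _ Mx My): Hp => E; subst p; split; last by exists y.
have M1 := Un_closed _ Mf; have M2 := Un_closed _ M1.
have M3 := upair_closed _ _ Mx My.
apply/in_Un => //; exists y; split=> //.
apply/in_Un => //; exists (upair x y); split; last by apply/in_upair; tauto.
apply/in_Un => //; exists (pr x y); split=> //.
by apply/in_upair; auto; apply: upair_closed.
Qed.

Lemma in_app (f x z : U) : M f -> M x ->
  (z ∈ app f x <-> exists y, M y /\ (pr x y ∈ f /\ z ∈ y)).
Proof.
move=> Mf Mx; have [s [_ Hs]] := app_model f x Mf Mx.
rewrite /app (setof_spec _ _ _ Hs) Hs; split.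
  move=> [p [pf [y [Hp zy]]]].
  have [_ My] := is_opair_model _ _ _ (model_trans _ _ Mf pf) Hp.
  by exists y; move/(is_opair_pr _ _ _ Mx My): Hp => <-.
move=> [y [My [Hf zy]]]; exists (pr x y); split=> //.
by exists y; split=> //; apply/is_opair_pr.
Qed.

Lemma DefT_app (f x : (nat -> U) -> U) :
  DefT M f -> DefT M x -> DefT M (fun e => app (f e) (x e)).
Proof.
move=> Hf Hx.
apply: (DefT_setof f (fun z e => exists p, p ∈ f e /\ exists y, is_opair p (x e) y /\ z ∈ y)).
  by move=> e He; apply: app_model; [apply Hf|apply Hx].
apply: (Def_ext M (fun e => exists y, M y /\
   (pr (x (fun n => e (S n))) y ∈ f (fun n => e (S n)) /\ e 0 ∈ y))).
  move=> e He; have He' : menv M (fun n => e (S n)) by move=> n; apply: He.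
  rewrite -in_app; [by apply Hf|by apply Hx|].
  have [s [_ Hs]] := app_model _ _ (proj1 Hf _ He') (proj1 Hx _ He').
  by rewrite /app (setof_spec _ _ _ Hs) Hs.
apply: (Def_ex M (fun y e => pr (x (fun n => e (S n))) y ∈ f (fun n => e (S n)) /\ e 0 ∈ y)).
apply: Def_and; apply: Def_mem; try exact: DefT_var.
  apply: DefT_pr; try exact: DefT_var; exact: (DefT_ren M (fun n => S (S n))).
exact: (DefT_ren M (fun n => S (S n))).
Qed.

End Closure.

(** Bounded quantifiers are tried before unbounded ones. The clause on hypotheses lets definability
    facts about local functions and relations take part; constants come last. *)
Ltac defn1 HM :=
  first
  [ simple apply Def_prop | simple apply Def_and | simple apply Def_or
  | simple apply Def_iff | simple apply Def_not | simple apply Def_imp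
  | simple apply (Def_ball2 HM) | simple apply (Def_ball HM)
  | apply Def_all | simple apply (Def_bex HM)
  | apply Def_ex | simple apply Def_mem | simple apply Def_eq
  | simple apply DefT_var
  | simple apply (DefT_upair HM) | simple apply (DefT_pr HM)
  | simple apply (DefT_cup HM) | simple apply (DefT_Un HM)
  | simple apply (DefT_cap HM) | simple apply (DefT_empty HM)
  | simple apply (DefT_app HM) | simple apply (DefT_lam HM)
  | simple apply (DefT_sep HM) | simple apply (DefT_img HM)
  | match goal with H : _ |- _ => simple apply H end
  | simple apply DefT_const ].

Ltac defn HM :=
  cbv beta; try assumption; try (solve [auto]);
  try (defn1 HM; defn HM).

Ltac inM HM :=
  try assumption;
  solve [ apply (DefT_closed HM); defn HM ].

(** * Relativized notions in terms of set operations *)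

Section Relativization.

Context {U : set_universe} {M : class U} (HM : transitive_ZFC_model M).

Lemma subset_sub (x y : U) : M x -> (subset M x y <-> sub x y).
Proof.
move=> Mx; split=> H z; last by move=> _; apply: H.
by move=> zx; apply: H => //; apply: (model_trans HM) zx.
Qed.

Lemma app_closed (f x : U) : M f -> M x -> M (app f x).
Proof. move=> *; inM HM. Qed.

Lemma cap_closed (x y : U) : M x -> M y -> M (cap x y).
Proof. move=> *; inM HM. Qed.

Lemma cup_closed (x y : U) : M x -> M y -> M (cup x y).
Proof. move=> *; inM HM. Qed.

Lemma empty_closed (x : U) : M x -> M (empty x).
Proof. move=> *; inM HM. Qed.

Lemma sep_closed (x : U) (P : U -> Prop) :
  M x -> Def M (fun e => P (e 0)) -> M (sep x P).
Proof. move=> Mx HP; apply (DefT_closed HM); apply: (DefT_sep HM); defn HM. Qed.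

Lemma img_closed (x : U) (t : U -> U) :
  M x -> DefT M (fun e => t (e 0)) -> M (img x t).
Proof. move=> Mx HP; apply (DefT_closed HM); apply: (DefT_img HM); defn HM. Qed.

Lemma lam_closed (x : U) (t : U -> U) :
  M x -> DefT M (fun e => t (e 0)) -> M (lam x t).
Proof. move=> Mx HP; apply (DefT_closed HM); apply: (DefT_lam HM); defn HM. Qed.

Lemma is_inter_cap (c x y : U) : M c -> M x -> M y ->
  (is_inter M c x y <-> c = cap x y).
Proof.
move=> Mc Mx My; split.
  move=> H; apply: set_ext => z; rewrite (in_cap HM) //; split=> Hz.
    by apply H => //; apply: (model_trans HM) Hz.
  by apply H => //; case: Hz => Hz _; apply: (model_trans HM) Hz.
by move=> -> z Mz; rewrite (in_cap HM).
Qed.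

Lemma is_pair_pr (p a b : U) : M p -> M a -> M b ->
  (is_pair M p a b <-> p = pr a b).
Proof.
move=> Mp Ma Mb.
have H c d z : M c -> M d -> M z ->
    ((all_in M (fun w => w ∈ z <-> w = c \/ w = d)) <-> z = upair c d).
  move=> Mc Md Mz; split.
    move=> H; apply: set_ext => w; rewrite (in_upair HM) //; split=> Hw.
      by apply H => //; apply: (model_trans HM) Hw.
    by apply H => //; case: Hw => ->.
  by move=> -> w _; rewrite (in_upair HM).
have H1 z : M z -> ((all_in M (fun w => w ∈ z <-> w = a)) <-> z = upair a a).
  move=> Mz; rewrite -H //; split=> K w Mw; rewrite K //; tauto.
have M1 := upair_closed HM a a Ma Ma; have M2 := upair_closed HM a b Ma Mb.
split.
  move=> K; apply: set_ext => z; rewrite (in_upair HM) //; split=> Hz.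
    have Mz := model_trans HM _ _ Mp Hz.
    by move/(K z Mz): Hz; rewrite H1 // H.
  have Mz : M z by case: Hz => ->.
  by apply/(K z Mz); rewrite H1 // H.
by move=> -> z Mz; rewrite (in_upair HM) // H1 // H.
Qed.

Lemma maps_to_pr (f x y : U) : M f -> M x -> M y ->
  (maps_to M f x y <-> pr x y ∈ f).
Proof.
move=> Mf Mx My; split.
  by move=> [p [Mp []]]; rewrite is_pair_pr // => ->.
move=> H; exists (pr x y); split; first exact: pr_closed.
by rewrite is_pair_pr //; exact: pr_closed.
Qed.

Lemma in_lam (x z : U) (t : U -> U) : M x -> DefT M (fun e => t (e 0)) ->
  (z ∈ lam x t <-> exists w, w ∈ x /\ z = pr w (t w)).
Proof. by move=> Mx Ht; rewrite /lam (in_img HM) //; defn HM. Qed.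

Lemma DefT_fun_closed (t : U -> U) (z : U) :
  DefT M (fun e => t (e 0)) -> M z -> M (t z).
Proof. by move=> [H _] Mz; apply: (H (fun _ => z)). Qed.

Lemma pr_in_lam (x z y : U) (t : U -> U) : M x -> DefT M (fun e => t (e 0)) ->
  M z -> M y -> (pr z y ∈ lam x t <-> z ∈ x /\ y = t z).
Proof.
move=> Mx Ht Mz My; rewrite in_lam //; split; last by move=> [zx ->]; exists z.
move=> [w [wx]]; have Mw := model_trans HM _ _ Mx wx.
move/(pr_inj HM) => [] //; first exact: DefT_fun_closed.
by move=> -> ->.
Qed.

Lemma app_eq (f x y : U) : M f -> M x -> M y -> pr x y ∈ f ->
  (forall y', M y' -> pr x y' ∈ f -> y' = y) -> app f x = y.
Proof.
move=> Mf Mx My Hy Hu; apply: set_ext => z; rewrite (in_app HM) //; split.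
  by move=> [y' [My' [/(Hu _ My') -> //]]].
by move=> zy; exists y.
Qed.

Lemma app_lam (x z : U) (t : U -> U) : M x -> DefT M (fun e => t (e 0)) ->
  z ∈ x -> app (lam x t) z = t z.
Proof.
move=> Mx Ht zx; have Mz := model_trans HM _ _ Mx zx.
have Mt : M (t z) by exact: DefT_fun_closed.
have Ml := lam_closed x t Mx Ht.
apply: app_eq => //; first by apply/pr_in_lam.
by move=> y' My' /pr_in_lam [].
Qed.

(** Passes from relational values to the total [app]. The domain is a class because lists are
    functions on the class [Pset]. *)
Lemma function_on_maps (f : U) (X : class U) (x y : U) :
  function_on M f X -> (forall z, X z -> M z) -> M f -> M x -> M y ->
  (maps_to M f x y <-> X x /\ y = app f x).
Proof.
move=> [H1 H2] HX Mf Mx My; rewrite maps_to_pr //.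
have key : X x -> exists v, M v /\ pr x v ∈ f /\ app f x = v /\
    forall v', M v' -> pr x v' ∈ f -> v' = v.
  move=> Xx; have [v [Mv [Hv Hu]]] := H2 x Mx Xx.
  move: Hv; rewrite maps_to_pr // => Hv.
  have Hu' v' : M v' -> pr x v' ∈ f -> v' = v.
    by move=> Mv' ?; apply: Hu => //; rewrite maps_to_pr.
  by exists v; split=> //; split=> //; split=> //; apply: app_eq.
split.
  move=> Hf; have Xx : X x.
    have [x' [Mx' [y' [My' [Xx' ]]]]] := H1 _ (pr_closed HM _ _ Mx My) Hf.
    rewrite is_pair_pr //; first exact: pr_closed.
    by move/(pr_inj HM) => [] // ->.
  by split=> //; have [v [Mv [Hv [-> Hu]]]] := key Xx; apply: Hu.
by move=> [/key [v [Mv [Hv [-> Hu]]]] ->].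
Qed.

Lemma lam_function_on (x : U) (t : U -> U) (X : class U) :
  M x -> DefT M (fun e => t (e 0)) -> (forall z, M z -> (X z <-> z ∈ x)) ->
  function_on M (lam x t) X.
Proof.
move=> Mx Ht HX; have Ml := lam_closed x t Mx Ht.
split.
  move=> p Mp; rewrite in_lam // => -[w [wx E]].
  have Mw := model_trans HM _ _ Mx wx.
  have Mt : M (t w) by exact: DefT_fun_closed.
  exists w; split=> //; exists (t w); split=> //; split; first by apply/HX.
  by rewrite is_pair_pr.
move=> z Mz /(HX z Mz) zx; have Mt : M (t z) by exact: DefT_fun_closed.
exists (t z); split=> //; split; first by rewrite maps_to_pr // pr_in_lam.
by move=> y My; rewrite maps_to_pr // pr_in_lam // => -[].
Qed.

(** The set [f] matters only through [app f] on [x]; it need not be a function with domain [x].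
    Where that is required, [lam x (app f)] takes its place. *)
Definition bij (x y : U) : Prop :=
  exists f, M f /\ (forall z, z ∈ x -> app f z ∈ y) /\
    (forall z z', z ∈ x -> z' ∈ x -> app f z = app f z' -> z = z') /\
    (forall w, w ∈ y -> exists z, z ∈ x /\ w = app f z).

Definition inj (x y : U) : Prop :=
  exists f, M f /\ (forall z, z ∈ x -> app f z ∈ y) /\
    (forall z z', z ∈ x -> z' ∈ x -> app f z = app f z' -> z = z').

Lemma inj_intro (x y : U) (t : U -> U) :
  M x -> DefT M (fun e => t (e 0)) -> (forall z, z ∈ x -> t z ∈ y) ->
  (forall z z', z ∈ x -> z' ∈ x -> t z = t z' -> z = z') -> inj x y.
Proof.
move=> Mx Ht H1 H2; exists (lam x t); split; first exact: lam_closed.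
split; first by move=> z zx; rewrite app_lam //; apply: H1.
by move=> z z' zx zx'; rewrite !app_lam //; apply: H2.
Qed.

Lemma bij_intro (x y : U) (t : U -> U) :
  M x -> DefT M (fun e => t (e 0)) -> (forall z, z ∈ x -> t z ∈ y) ->
  (forall z z', z ∈ x -> z' ∈ x -> t z = t z' -> z = z') ->
  (forall w, w ∈ y -> exists z, z ∈ x /\ w = t z) -> bij x y.
Proof.
move=> Mx Ht H1 H2 H3; exists (lam x t); split; first exact: lam_closed.
split; first by move=> z zx; rewrite app_lam //; apply: H1.
split; first by move=> z z' zx zx'; rewrite !app_lam //; apply: H2.
by move=> w /H3 [z [zx ->]]; exists z; split=> //; rewrite app_lam.
Qed.

Lemma bij_inj (x y : U) : bij x y -> inj x y.
Proof. by move=> [f [? [? [? _]]]]; exists f. Qed.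

Lemma equinumerous_bij (x y : U) : M x -> M y -> (equinumerous M x y <-> bij x y).
Proof.
move=> Mx My; split.
  move=> [f [Mf [Hf [H1 H2]]]].
  have HX z : z ∈ x -> M z by apply: (model_trans HM).
  have E u v : M u -> M v -> (maps_to M f u v <-> u ∈ x /\ v = app f u).
    by move=> Mu Mv; apply: (function_on_maps f (fun w => w ∈ x)).
  have Ma u : u ∈ x -> M (app f u) by move=> /HX; apply: app_closed.
  exists f; split=> //; split.
    by move=> z zx; apply: (H1 z (HX z zx) (app f z) (Ma z zx)); apply/E; auto.
  have surj w : w ∈ y -> exists z, z ∈ x /\ w = app f z /\
      forall z', z' ∈ x -> w = app f z' -> z' = z.
    move=> wy; have Mw := model_trans HM _ _ My wy.
    have [u [Mu []]] := H2 w Mw wy; rewrite E // => -[ux Ew] Hu.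
    exists u; split=> //; split=> // z' zx' Ez'; apply: Hu; auto.
    by apply/E; auto.
  split; last by move=> w /surj [z [? [? _]]]; exists z.
  move=> z z' zx zx' Ez.
  have zy : app f z ∈ y by apply: (H1 z (HX z zx) _ (Ma z zx)); apply/E; auto.
  by have [u [ux [_ Hu]]] := surj _ zy; rewrite (Hu z) // (Hu z').
move=> [f [Mf [H1 [H2 H3]]]].
have Ht : DefT M (fun e => app f (e 0)) by defn HM.
have Ml := lam_closed x (app f) Mx Ht.
exists (lam x (app f)); split=> //; split.
  exact: lam_function_on.
split.
  move=> u Mu v Mv; rewrite maps_to_pr // pr_in_lam // => -[ux ->].
  exact: H1.
move=> v Mv /H3 [u [ux Ev]]; have Mu := model_trans HM _ _ Mx ux.
exists u; split=> //; split; first by rewrite maps_to_pr // pr_in_lam.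
move=> u' Mu'; rewrite maps_to_pr // pr_in_lam // => -[ux' Ev'].
by apply: H2 => //; rewrite -Ev.
Qed.

Lemma inj_trans (x y z : U) : M x -> inj x y -> inj y z -> inj x z.
Proof.
move=> Mx [f [Mf [F1 F2]]] [g [Mg [G1 G2]]].
apply: (inj_intro _ _ (fun w => app g (app f w))) => //; first defn HM.
  by move=> w /F1 /G1.
by move=> w w' wx wx' /G2 H; apply: F2 => //; apply: H; apply: F1.
Qed.

Lemma inj_sub (x y : U) : M x -> sub x y -> inj x y.
Proof.
by move=> Mx H; apply: (inj_intro _ _ (fun w => w)) => //; defn HM.
Qed.

End Relativization.

Arguments bij {U} M x y.
Arguments inj {U} M x y.

(** * Ordinals of the ambient structure *)

Section Ordinals.

Context {U : set_universe}.
Implicit Types (x y z α β γ : U).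

(** Free of any model, hence common to [V] and [W]. Well-foundedness comes from the ambient
    membership and gives minima for arbitrary, also undefinable, predicates. *)
Definition Ord α : Prop :=
  (forall x, x ∈ α -> sub x α) /\
  (forall x y, x ∈ α -> y ∈ α -> x ∈ y \/ x = y \/ y ∈ x).

Lemma mem_min (P : U -> Prop) :
  (exists x, P x) -> exists x, P x /\ forall y, y ∈ x -> ~ P y.
Proof.
move=> [x Px]; apply NNPP => H; move: x Px.
apply: (well_founded_ind (mem_wf U)) => x IH Px.
by apply H; exists x.
Qed.

Lemma mem_irrefl x : ~ x ∈ x.
Proof.
by elim/(well_founded_ind (mem_wf U)): x => x IH xx; exact: (IH x xx xx).
Qed.

Lemma mem_asym x y : x ∈ y -> ~ y ∈ x.
Proof.
elim/(well_founded_ind (mem_wf U)): x y => x IH y xy yx.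
exact: (IH y yx x yx xy).
Qed.

Lemma mem_acyc3 x y z : x ∈ y -> y ∈ z -> ~ z ∈ x.
Proof.
elim/(well_founded_ind (mem_wf U)): x y z => x IH y z xy yz zx.
exact: (IH z zx x y zx xy yz).
Qed.

Lemma Ord_mem α β : Ord α -> β ∈ α -> Ord β.
Proof.
move=> [T L] ba; split.
  move=> x xb z zx.
  have xa : x ∈ α by apply: T ba _ xb.
  have za : z ∈ α by apply: T xa _ zx.
  have [//|[E|bz]] := L z β za ba; first by subst z; case: (mem_asym _ _ xb zx).
  by case: (mem_acyc3 _ _ _ zx xb bz).
by move=> x y xb yb; apply: L; apply: T ba _ _.
Qed.

Lemma Ord_trans α β γ : Ord α -> β ∈ α -> γ ∈ β -> γ ∈ α.
Proof. by move=> [T _] ba gb; apply: T ba _ gb. Qed.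

(** If the inclusion is proper, then [β] is the least element of the complement. *)
Lemma Ord_sub_cases α β : Ord α -> Ord β -> sub β α -> β ∈ α \/ β = α.
Proof.
move=> Oa Ob ba; have [H|H] := classic (sub α β).
  by right; apply: sub_antisym.
left.
have [|g [[ga gb] Hg]] := mem_min (fun g => g ∈ α /\ ~ g ∈ β).
  apply NNPP => K; apply H => z za; apply NNPP => zb; apply K; by exists z.
suff -> : β = g by [].
apply: sub_antisym => z.
  move=> zb; have [//|[E|gz]] := proj2 Oa z g (ba _ zb) ga; first by subst z.
  by case: gb; apply: Ord_trans Ob zb gz.
move=> zg; apply NNPP => zb; apply: (Hg z zg); split=> //.
exact: Ord_trans Oa ga zg.
Qed.

Lemma Ord_mem_sub α β : Ord α -> β ∈ α -> sub β α.
Proof. by move=> [T _]; apply: T. Qed.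

End Ordinals.

Lemma ordinal_Ord {U : set_universe} {M : class U} (HM : transitive_ZFC_model M)
  (α : U) : M α -> (ordinal M α <-> Ord α).
Proof.
move=> Ma; have T := model_trans HM; split=> -[H1 H2]; split.
- by move=> x xa; apply/(subset_sub HM); [apply: T xa|apply: H1 => //; apply: T xa].
- by move=> x y xa ya; apply: H2 => //; [apply: T xa|apply: T ya].
- by move=> x Mx xa; apply/(subset_sub HM) => //; apply: H1.
- by move=> x Mx y My; apply: H2.
Qed.

(** * Recursion, choice and cardinality inside a model *)

Section Recursion.

Context {U : set_universe} {M : class U} (HM : transitive_ZFC_model M).

(** This and the next two lemmas turn definability in the first slots into a rule closed under
    substitution of terms, the form that [defn] can use. *)
Lemma Def_rel2 (r : U -> U -> Prop) : Def M (fun e => r (e 0) (e 1)) ->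
  forall s t, DefT M s -> DefT M t -> Def M (fun e => r (s e) (t e)).
Proof.
move=> Hr s t Hs Ht; apply: (Def_subst M (fun x e => r x (t e))) => //.
apply: (Def_subst M (fun y e => r (e 0) y)); first exact: (DefT_ren M S).
exact: (Def_ren M (fun n => match n with O => 1 | _ => O end) _ Hr).
Qed.

Lemma DefT_fun1 (g : U -> U) : DefT M (fun e => g (e 0)) ->
  forall s, DefT M s -> DefT M (fun e => g (s e)).
Proof.
move=> Hg s Hs; split.
  by move=> e He; apply: (proj1 Hg (fun _ => s e)) => n; apply Hs.
apply: (Def_subst M (fun x e => e 0 = g x)); first exact: (DefT_ren M S).
by apply: Def_eq; [apply: DefT_var|].
Qed.

Lemma DefT_fun2 (g : U -> U -> U) : DefT M (fun e => g (e 0) (e 1)) ->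
  forall s t, DefT M s -> DefT M t -> DefT M (fun e => g (s e) (t e)).
Proof.
move=> Hg s t Hs Ht; split.
  move=> e He; apply: (proj1 Hg (env_cons (s e) (fun _ => t e))).
  by apply: menv_cons; [apply Hs|move=> n; apply Ht].
apply: (Def_subst M (fun x e => e 0 = g x (t (fun n => e (S n))))).
  exact: (DefT_ren M S).
apply: (Def_subst M (fun y e => e 1 = g (e 0) y)).
  exact: (DefT_ren M (fun n => S (S n))).
apply: Def_eq; first exact: DefT_var.
exact: (DefT_ren M (fun n => match n with O => 1 | _ => O end) _ Hg).
Qed.

Lemma lam_ext (x : U) (s t : U -> U) :
  M x -> DefT M (fun e => s (e 0)) -> DefT M (fun e => t (e 0)) ->
  (forall z, z ∈ x -> s z = t z) -> lam x s = lam x t.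
Proof.
move=> Mx Hs Ht E; apply: set_ext => z; rewrite !(in_lam HM) //.
by split=> -[w [wx ->]]; exists w; rewrite E.
Qed.

(** The function is glued from approximations [p] on predecessor-closed sets [d], which is definable
    over [M]. Accessibility is a statement of the metatheory: it is used only for induction, to show
    that approximations agree and that they reach every point. *)
Lemma recursion (X : U) (r : U -> U -> Prop) (g : U -> U -> U) :
  M X -> Def M (fun e => r (e 0) (e 1)) -> DefT M (fun e => g (e 0) (e 1)) ->
  (forall x, x ∈ X -> Acc (fun y z => y ∈ X /\ r y z) x) ->
  exists f, M f /\ forall x, x ∈ X ->
    app f x = g x (lam (sep X (fun y => r y x)) (app f)).
Proof.
move=> MX Hr0 Hg0 Hwf.
have Hr := Def_rel2 _ Hr0; have Hg := DefT_fun2 _ Hg0; clear Hr0 Hg0.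
pose prd x := sep X (fun y => r y x).
have Tr := model_trans HM.
have Hprd s : DefT M s -> DefT M (fun e => prd (s e)).
  move=> Hs; apply: (DefT_sep HM); first exact: DefT_const.
  by apply: Hr; [apply: DefT_var|apply: (DefT_ren M S)].
have Mprd x : M x -> M (prd x).
  by move=> Mx; apply: (DefT_closed HM); apply: Hprd; apply: DefT_const.
have in_prd x y : M x -> (y ∈ prd x <-> y ∈ X /\ r y x).
  move=> Mx; rewrite (in_sep HM) //; defn HM.
pose att d p := sub d X /\ (forall x, x ∈ d -> sub (prd x) d) /\
  forall x, x ∈ d -> app p x = g x (lam (prd x) (app p)).
have Happ p : M p -> DefT M (fun e => app p (e 0)) by move=> Mp; defn HM.
have agree d p d' p' x : M d -> M p -> M d' -> M p' -> att d p -> att d' p' ->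
    x ∈ d -> x ∈ d' -> app p x = app p' x.
  move=> Md Mp Md' Mp' [Hd [Hc Hp]] [Hd' [Hc' Hp']] xd.
  have A := Hwf x (Hd x xd); elim: A xd => {}x _ IH xd xd'.
  rewrite Hp // Hp' //; congr (g x _).
  have Mx := Tr _ _ Md xd.
  apply: lam_ext; auto => z zx; apply: IH; try by apply: Hc zx.
    by apply/in_prd.
  by apply: Hc' zx.
have Hatt s t : DefT M s -> DefT M t -> Def M (fun e => att (s e) (t e)).
  apply: Def_rel2; rewrite /att /sub; defn HM.
pose Good := sep X (fun y => exists d, M d /\ exists p, M p /\ (att d p /\ y ∈ d)).
have HGood : Def M (fun e => exists d, M d /\ exists p, M p /\ (att d p /\ e 0 ∈ d)).
  defn HM.
have MG : M Good by exact: (sep_closed HM).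
have inG y : y ∈ Good <-> exists d p, M d /\ M p /\ att d p /\ y ∈ d.
  rewrite (in_sep HM) //; split.
    by move=> [_ [d [Md [p [Mp [? ?]]]]]]; exists d, p.
  move=> [d [p [Md [Mp [A yd]]]]]; split; first by apply (proj1 A).
  by exists d; split=> //; exists p.
(* The union of the values of all approximations at [y]; they agree, so it is their common value on
   [Good] and empty elsewhere. *)
pose t y := setof y (fun z => exists d, M d /\
  exists p, M p /\ (att d p /\ (y ∈ d /\ z ∈ app p y))).
have t_att d p y : M d -> M p -> att d p -> y ∈ d -> t y = app p y.
  move=> Md Mp A yd; apply: setof_spec => z; split.
    by move=> zp; exists d; split=> //; exists p.
  move=> [d' [Md' [p' [Mp' [A' [yd' zp]]]]]].
  by rewrite (agree d p d' p').
have Ht : DefT M (fun e => t (e 0)).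
  apply: (DefT_setof HM (fun e => e 0) (fun z e => exists d, M d /\
    exists p, M p /\ (att d p /\ (e 0 ∈ d /\ z ∈ app p (e 0))))); last by defn HM.
  move=> e He; have [/inG [d [p [Md [Mp [A yd]]]]]|nG] := classic (e 0 ∈ Good).
    exists (app p (e 0)); split; first exact: (app_closed HM).
    move=> z; split; first by move=> zp; exists d; split=> //; exists p.
    move=> [d' [Md' [p' [Mp' [A' [yd' zp]]]]]].
    by rewrite (agree d p d' p').
  exists (empty X); split; first exact: (empty_closed HM).
  move=> z; split; first by move/(in_empty HM _ _ MX).
  move=> [d [Md [p [Mp [A [yd _]]]]]]; case: nG; apply/inG.
  by exists d, p.
pose ps := lam Good t.
have Mps : M ps by exact: (lam_closed HM).
have attG : att Good ps.
  split; first by move=> y; rewrite (in_sep HM) // => -[].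
  split.
    move=> y /inG [d [p [Md [Mp [A yd]]]]] z zy; apply/inG.
    by exists d, p; split=> //; split=> //; split=> //; apply: (proj1 (proj2 A)) zy.
  move=> y yG; rewrite (app_lam HM) //.
  move/inG: (yG) => [d [p [Md [Mp [A yd]]]]].
  have My := Tr _ _ Md yd.
  rewrite (t_att d p) // (proj2 (proj2 A)) //; congr (g y _).
  apply: lam_ext; auto => z zy.
  have zd : z ∈ d by apply: (proj1 (proj2 A)) zy.
  rewrite (app_lam HM) //; first by apply/inG; exists d, p.
  by rewrite (t_att d p).
have all x : x ∈ X -> x ∈ Good.
  move=> xX; have A := Hwf x xX; elim: A xX => {}x _ IH xX.
  have Mx := Tr _ _ MX xX.
  have prdG : sub (prd x) Good.
    by move=> y /(in_prd _ _ Mx) Hy; apply: IH => //; apply Hy.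
  pose t' y := g y (lam (prd y) (app ps)).
  have Ht' : DefT M (fun e => t' (e 0)) by rewrite /t'; defn HM.
  (* All predecessors of [x] are reached, so [Good] together with [x] carries an approximation, and
     [x] belongs to [Good]. *)
  pose d' := cup Good (upair x x).
  have Mu : M (upair x x) by inM HM.
  have Md' : M d' by exact: (cup_closed HM).
  have in_d' y : y ∈ d' <-> y ∈ Good \/ y = x.
    by rewrite (in_cup HM) // (in_upair HM) //; tauto.
  have subG : sub Good d' by move=> y yG; apply/in_d'; left.
  have prd' y : y ∈ d' -> sub (prd y) Good.
    by move=> /in_d' [yG|->] //; apply: (proj1 (proj2 attG)).
  apply/inG; exists d', (lam d' t'); split=> //.
  split; first exact: (lam_closed HM).
  split; last by apply/in_d'; right.
  have Ml : M (lam d' t') by exact: (lam_closed HM).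
  split; first by move=> y /in_d' [/(proj1 attG)//|->].
  split; first by move=> y yd z zy; apply: subG; apply: prd' zy.
  move=> y yd; rewrite (app_lam HM) //; congr (g y _).
  have My := Tr _ _ Md' yd.
  apply: lam_ext; auto => z zy; have zG := prd' y yd z zy.
  rewrite (app_lam HM) //; first exact: subG.
  exact: (proj2 (proj2 attG)).
exists ps; split=> // x xX; apply: (proj2 (proj2 attG)); exact: all.
Qed.

(** The sets [K z] of pairs with first entry [z] are disjoint, so the axiom of choice for disjoint
    families yields the graph of a choice function. *)
Lemma model_choice (x Y : U) (P : U -> U -> Prop) :
  M x -> M Y -> Def M (fun e => P (e 0) (e 1)) ->
  (forall z, z ∈ x -> exists w, w ∈ Y /\ P z w) ->
  exists h, M h /\ forall z, z ∈ x -> app h z ∈ Y /\ P z (app h z).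
Proof.
move=> Mx MY HP0 Hex.
have HP := Def_rel2 _ HP0; clear HP0.
have Tr := model_trans HM.
pose K z := img (sep Y (P z)) (pr z).
have HK : DefT M (fun e => K (e 0)).
  by apply: (DefT_img HM (fun e => sep Y (P (e 0))) (fun w e => pr (e 0) w)); defn HM.
have in_K z p : M z -> (p ∈ K z <-> exists w, w ∈ Y /\ P z w /\ p = pr z w).
  move=> Mz; have HPz : Def M (fun e => P z (e 0)) by defn HM.
  rewrite (in_img HM); [exact: (sep_closed HM)|defn HM|].
  split=> -[w H]; exists w; move: H; rewrite (in_sep HM) //; tauto.
pose Fam := img x K.
have MF : M Fam by exact: (img_closed HM).
have in_F k : k ∈ Fam <-> exists z, z ∈ x /\ k = K z by rewrite (in_img HM).
have [_ [_ _ _ _ _ _ Hc _ _]] := HM.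
have [] := Hc Fam MF.
- move=> k Mk /in_F [z [zx ->]]; have Mz := Tr _ _ Mx zx.
  have [w [wY Pw]] := Hex z zx; exists (pr z w); split.
    by apply: (pr_closed HM) => //; apply: Tr wY.
  by apply/in_K => //; exists w.
- move=> k Mk k' Mk' /in_F [z [zx ->]] /in_F [z' [zx' ->]].
  have Mz := Tr _ _ Mx zx; have Mz' := Tr _ _ Mx zx'.
  move=> [p [Mp [/(in_K _ _ Mz) [w [wY [_ E]]] /(in_K _ _ Mz') [w' [wY' [_ E']]]]]].
  have Mw := Tr _ _ MY wY; have Mw' := Tr _ _ MY wY'.
  by have [-> _] := pr_inj HM _ _ _ _ Mz Mw Mz' Mw' (eq_trans (eq_sym E) E').
move=> c [Mc HcF].
(* The choice set may contain further pairs outside the family, which would add to the values of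
   [app]. *)
pose h := cap c (Un Fam).
have MUF : M (Un Fam) by exact: (Un_closed HM).
have Mh : M h by exact: (cap_closed HM).
exists h; split=> // z zx; have Mz := Tr _ _ Mx zx.
have KF : K z ∈ Fam by apply/in_F; exists z.
have [p [Mp [[pK pc] Hu]]] := HcF (K z) (Tr _ _ MF KF) KF.
move/(in_K _ _ Mz): (pK) => [w [wY [Pw E]]]; have Mw := Tr _ _ MY wY.
suff -> : app h z = w by [].
apply: (app_eq HM) => //.
  by apply/(in_cap HM) => //; rewrite -E; split=> //; apply/(in_Un HM) => //; exists (K z).
move=> w' Mw' /(in_cap HM) [] // pc' /(in_Un HM) [] // k [/in_F [z' [zx' ->]] Hp].
have Mz' := Tr _ _ Mx zx'.
move/(in_K _ _ Mz'): (Hp) => [w'' [wY'' [Pw'' E'']]].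
have Mw'' := Tr _ _ MY wY''.
have [] := pr_inj HM _ _ _ _ Mz Mw' Mz' Mw'' E''.
move=> ? ?; subst z' w''.
have Ep : pr z w' = p by apply: Hu => //; exact: (pr_closed HM).
by have [] := pr_inj HM _ _ _ _ Mz Mw' Mz Mw (eq_trans Ep E).
Qed.

(** The recursion defines [app c x] for every [x ∈ α] as the order type of [I ∩ x]; induction shows
    that it is an ordinal not above [x]. *)
Lemma collapse (I α : U) : M I -> M α -> Ord α -> sub I α ->
  exists β, M β /\ Ord β /\ sub β α /\ bij M I β.
Proof.
move=> MI Ma Oa Ia; have Tr := model_trans HM.
have [] := recursion α (fun y x => y ∈ x) (fun x s => img (cap I x) (app s)) Ma.
- defn HM.
- defn HM.
- move=> x _; elim/(well_founded_ind (mem_wf U)): x => x IH.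
  by constructor=> y [_ yx]; apply: IH.
move=> c [Mc Hc0].
have in_c x z : x ∈ α -> (z ∈ app c x <-> exists y, y ∈ I /\ y ∈ x /\ z = app c y).
  move=> xa; have Mx := Tr _ _ Ma xa.
  have HD : Def M (fun e => e 0 ∈ x) by defn HM.
  have Ms := sep_closed HM α (fun y => y ∈ x) Ma HD.
  have Hapc : DefT M (fun e => app c (e 0)) by defn HM.
  have Ml := lam_closed HM _ (app c) Ms Hapc.
  rewrite Hc0 // (in_img HM); [exact: (cap_closed HM)|defn HM|].
  split.
    move=> [y [/(in_cap HM) [] // yI yx ->]]; exists y; split=> //; split=> //.
    by rewrite (app_lam HM) //; apply/(in_sep HM) => //; split=> //; apply: Ia.
  move=> [y [yI [yx ->]]]; exists y; split; first by apply/(in_cap HM).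
  by rewrite (app_lam HM) //; apply/(in_sep HM) => //; split=> //; apply: Ia.
have mono y y' : y ∈ I -> y' ∈ I -> y ∈ y' -> app c y ∈ app c y'.
  by move=> yI yI' yy'; apply/in_c; [apply: Ia|exists y].
have lin y y' : y ∈ I -> y' ∈ I ->
    app c y ∈ app c y' \/ app c y = app c y' \/ app c y' ∈ app c y.
  move=> yI yI'; have := proj2 Oa y y' (Ia _ yI) (Ia _ yI').
  by move=> [?|[->|?]]; [left|right; left|right; right]; auto.
have le x : x ∈ α -> Ord (app c x) /\ (app c x ∈ x \/ app c x = x).
  elim/(well_founded_ind (mem_wf U)): x => x IH xa.
  have Ox := Ord_mem _ _ Oa xa.
  have Oc : Ord (app c x).
    split.
      move=> z /(in_c _ _ xa) [y [yI [yx ->]]] w.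
      have ya := Ia _ yI.
      move=> /(in_c _ _ ya) [y' [yI' [yy' ->]]]; apply/in_c => //.
      by exists y'; split=> //; split=> //; apply: (Ord_trans x y).
    by move=> z z' /(in_c _ _ xa) [y [yI [_ ->]]] /(in_c _ _ xa) [y' [yI' [_ ->]]]; apply: lin.
  split=> //; apply: Ord_sub_cases => // z /(in_c _ _ xa) [y [yI [yx ->]]].
  have [_ [H|->//]] := IH y yx (Ia _ yI).
  exact: (Ord_trans x y).
have Hapc : DefT M (fun e => app c (e 0)) by defn HM.
have in_b z : z ∈ img I (app c) <-> exists y, y ∈ I /\ z = app c y by rewrite (in_img HM).
have Ob : Ord (img I (app c)).
  split.
    move=> z /in_b [y [yI ->]] w /(in_c _ _ (Ia _ yI)) [y' [yI' [yy' ->]]].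
    by apply/in_b; exists y'.
  by move=> z z' /in_b [y [yI ->]] /in_b [y' [yI' ->]]; apply: lin.
exists (img I (app c)); split; first exact: (img_closed HM).
split=> //; split.
  move=> z /in_b [y [yI ->]]; have ya := Ia _ yI.
  by have [_ [H|->//]] := le y ya; apply: (Ord_trans α y).
exists c; split=> //; split; first by move=> y yI; apply/in_b; exists y.
split; last by move=> w /in_b.
move=> y y' yI yI' E.
have := proj2 Oa y y' (Ia _ yI) (Ia _ yI').
move=> [H|[//|H]]; have := mono _ _ _ _ H; rewrite E => K; case: (mem_irrefl _ (K _ _)) => //.
Qed.

(** Injections into an ordinal remain injections in a larger model, whereas a cardinal may cease to
    be one; this form of smallness is visibly upward absolute. *)
Lemma card_lt_inj (x κ : U) : M x -> M κ -> Ord κ ->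
  (card_lt M x κ <-> exists α, α ∈ κ /\ inj M x α).
Proof.
move=> Mx Mk Ok; have Tr := model_trans HM; split.
  move=> [μ [Mμ [[_ Hb] μk]]]; exists μ; split=> //.
  by apply: bij_inj; apply/(equinumerous_bij HM).
move=> [α0 [ak ia]].
have [|β [[bk ib] Hmin]] := mem_min (fun β => β ∈ κ /\ inj M x β).
  by exists α0.
have Mb := Tr _ _ Mk bk; have Ob := Ord_mem _ _ Ok bk.
(* The image of [x] in [β] collapses to an ordinal not above [β]; by minimality of [β] it is [β]
   itself. *)
have bx : bij M x β.
  have [f [Mf [F1 F2]]] := ib.
  have Hf : DefT M (fun e => app f (e 0)) by defn HM.
  have MI := img_closed HM _ (app f) Mx Hf.
  have in_I z : z ∈ img x (app f) <-> exists y, y ∈ x /\ z = app f y by rewrite (in_img HM).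
  have [|γ [Mg [Og [gb [g [Mg' [G1 [G2 G3]]]]]]]] := collapse _ β MI Mb Ob.
    by move=> z /in_I [y [yx ->]]; apply: F1.
  have bg : bij M x γ.
    apply: (bij_intro HM _ _ (fun z => app g (app f z))) => //; first defn HM.
    - by move=> z zx; apply: G1; apply/in_I; exists z.
    - move=> z z' zx zx' E; apply: F2 => //; apply: G2 => //; apply/in_I.
        by exists z.
      by exists z'.
    - by move=> w /G3 [z [/in_I [y [yx ->]] ->]]; exists y.
  have [gb'|<- //] := Ord_sub_cases _ _ Ob Og gb.
  case: (Hmin γ gb'); split; first exact: (Ord_trans κ β).
  exact: bij_inj.
exists β; split=> //; split=> //; split; last by apply/(equinumerous_bij HM).
split; first by apply/(ordinal_Ord HM).
move=> α Ma ab /(equinumerous_bij HM _ _ Ma Mb) [f [Mf [F1 [F2 F3]]]].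
apply: (Hmin α ab); split; first exact: (Ord_trans κ β).
apply: (inj_trans HM _ β) => //.
have inv_exists w : w ∈ β -> exists z, z ∈ α /\ w = app f z by apply: F3.
have [|h [Mh Hh]] := model_choice β α (fun w z => w = app f z) Mb Ma _ inv_exists.
  defn HM.
exists h; split=> //; split; first by move=> z /Hh [].
move=> z z' /Hh [_ E] /Hh [_ E'] Ez; by rewrite E E' Ez.
Qed.

Lemma inj_of_image (X y α : U) (t : U -> U) :
  M X -> M y -> M α -> Ord α -> inj M y α -> DefT M (fun e => t (e 0)) ->
  (forall w, w ∈ X -> exists z, z ∈ y /\ w = t z) -> inj M X α.
Proof.
move=> MX My Ma Oa [f [Mf [F1 F2]]] Ht Hex; have Tr := model_trans HM.
have Ht1 := DefT_fun1 _ Ht; clear Ht.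
(* The least index of a preimage of [w], written as the intersection of all such indices. *)
pose lst w := sep α (fun j => forall z, z ∈ y -> w = t z -> j ∈ app f z).
have key w : w ∈ X -> exists z, z ∈ y /\ w = t z /\ lst w = app f z.
  move=> wX; have Mw := Tr _ _ MX wX.
  have [|i [[z [zy [Ew Ei]]] Hmin]] :=
      mem_min (fun i => exists z, z ∈ y /\ w = t z /\ i = app f z).
    by have [z [zy E]] := Hex w wX; exists (app f z), z.
  exists z; split=> //; split=> //; subst i.
  have HD : Def M (fun e => forall z, z ∈ y -> w = t z -> e 0 ∈ app f z) by defn HM.
  apply: set_ext => j; rewrite (in_sep HM) //; split.
    by move=> [_]; apply.
  move=> jz; split; first exact: (Ord_trans α (app f z)) (F1 _ zy) jz.
  move=> z' zy' Ew'; have := proj2 Oa _ _ (F1 _ zy) (F1 _ zy').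
  move=> [H|[<-//|H]].
    by apply: (Ord_trans (app f z') (app f z)) => //; apply: Ord_mem (F1 _ zy').
  by case: (Hmin _ H); exists z'.
apply: (inj_intro HM _ _ lst) => //.
- rewrite /lst; defn HM.
- by move=> w /key [z [zy [_ ->]]]; apply: F1.
- move=> w w' /key [z [zy [Ez ->]]] /key [z' [zy' [-> ->]]] E.
  by rewrite (F2 _ _ zy zy' E) in Ez.
Qed.

Lemma inj_pow (x y : U) : M x -> M y -> inj M x y -> inj M (pow M x) (pow M y).
Proof.
move=> Mx My [f [Mf [F1 F2]]]; have Mpx := pow_closed HM _ Mx.
have Hf : DefT M (fun e => app f (e 0)) by defn HM.
have in_i s z : M s -> (z ∈ img s (app f) <-> exists w, w ∈ s /\ z = app f w).
  by move=> Ms; rewrite (in_img HM).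
apply: (inj_intro HM _ _ (fun s => img s (app f))) => //; first defn HM.
  move=> s /(in_pow HM _ _ Mx) [Ms sx]; apply/(in_pow HM) => //.
  split; first exact: (img_closed HM).
  by move=> z /(in_i _ _ Ms) [w [ws ->]]; apply/F1/sx.
have half s s' : s ∈ pow M x -> s' ∈ pow M x ->
    img s (app f) = img s' (app f) -> sub s s'.
  move=> /(in_pow HM _ _ Mx) [Ms sx] /(in_pow HM _ _ Mx) [Ms' sx'] E z zs.
  have : app f z ∈ img s (app f) by apply/in_i => //; exists z.
  rewrite E => /(in_i _ _ Ms') [z' [zs' Ez]].
  by rewrite (F2 z z') //; [apply: sx|apply: sx'].
by move=> s s' Hs Hs' E; apply: sub_antisym; apply: half.
Qed.

Lemma Cantor (x : U) : M x -> ~ inj M (pow M x) x.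
Proof.
move=> Mx [f [Mf [F1 F2]]]; have Mp := pow_closed HM _ Mx.
(* The diagonal set for an injection: the codes of those sets that do not contain their own code. *)
pose P i := exists s, s ∈ pow M x /\ (i = app f s /\ ~ i ∈ s).
have HP : Def M (fun e => P (e 0)) by rewrite /P; defn HM.
pose D := sep x P.
have Dp : D ∈ pow M x.
  apply/(in_pow HM) => //; split; first exact: (sep_closed HM).
  by move=> z /(in_sep HM _ _ _ Mx HP) [].
have nD : ~ app f D ∈ D.
  move=> H; move/(in_sep HM _ _ _ Mx HP): (H) => [_ [s [sp [E nH]]]].
  by rewrite -(F2 _ _ Dp sp E) in nH.
apply: (nD); apply/(in_sep HM) => //; split; first exact: F1.
by exists D.
Qed.

End Recursion.

(** * Small sets, clubs and stationary sets *)

Definition small {U : set_universe} (M : class U) (κ x : U) : Prop :=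
  exists α, α ∈ κ /\ inj M x α.

(** The class [Pset] as a set: [PM V κ λ] can thus occur as a parameter in formulas over [W]. *)
Definition PM {U : set_universe} (M : class U) (κ λ : U) : U :=
  sep (pow M λ) (small M κ).

(* Regularity in the form which transfers along covering. *)
Definition reg_bound {U : set_universe} (M : class U) (κ : U) : Prop :=
  forall x, M x -> sub x κ -> small M κ x -> exists β, β ∈ κ /\ sub x β.

(** What [V] and [W] have in common. The strong limit property is left out, as new subsets in [W]
    may destroy it. *)
Record setting {U : set_universe} (M : class U) (κ λ : U) : Prop := Setting {
  set_model : transitive_ZFC_model M;
  set_Mk : M κ;
  set_Ml : M λ;
  set_Ok : Ord κ;
  set_Ol : Ord λ;
  set_kl : κ ∈ λ \/ κ = λ;
  set_lim : forall β, β ∈ κ -> exists γ, γ ∈ κ /\ β ∈ γ;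
  set_ne : exists β, β ∈ κ;
  set_reg : reg_bound M κ }.

Section Small.

Context {U : set_universe} {M : class U} {κ λ : U} (HS : setting M κ λ).

Let HM := set_model _ _ _ HS.
Let Mk := set_Mk _ _ _ HS.
Let Ml := set_Ml _ _ _ HS.
Let Ok := set_Ok _ _ _ HS.
Let Ol := set_Ol _ _ _ HS.
Let Tr := model_trans HM.

Lemma small_card_lt (x : U) : M x -> (card_lt M x κ <-> small M κ x).
Proof. by move=> Mx; apply: (card_lt_inj HM). Qed.

Lemma small_inj (x y : U) : M x -> inj M x y -> small M κ y -> small M κ x.
Proof.
by move=> Mx H [α [ak H']]; exists α; split=> //; apply: (inj_trans HM _ y).
Qed.

Lemma small_sub (x y : U) : M x -> sub x y -> small M κ y -> small M κ x.
Proof. by move=> Mx H; apply: small_inj => //; apply: (inj_sub HM). Qed.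

Lemma small_image (X y : U) (t : U -> U) :
  M X -> M y -> small M κ y -> DefT M (fun e => t (e 0)) ->
  (forall w, w ∈ X -> exists z, z ∈ y /\ w = t z) -> small M κ X.
Proof.
move=> MX My [α [ak H]] Ht Hex; exists α; split=> //.
apply: (inj_of_image HM _ y _ t) => //; first exact: Tr ak.
exact: Ord_mem ak.
Qed.

Lemma small_of_index (x α : U) : M x -> α ∈ κ -> sub x α -> small M κ x.
Proof. by move=> Mx ak xa; exists α; split=> //; apply: (inj_sub HM). Qed.

Lemma Def_small : Def M (fun e => small M κ (e 0)).
Proof. rewrite /small /inj; defn HM. Qed.

Lemma MP : M (PM M κ λ).
Proof.
by apply: (sep_closed HM); [apply: (pow_closed HM)|apply: Def_small].
Qed.

Lemma in_P (a : U) : a ∈ PM M κ λ <-> M a /\ sub a λ /\ small M κ a.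
Proof.
rewrite (in_sep HM); [exact: (pow_closed HM)|exact: Def_small|].
rewrite (in_pow HM) //; tauto.
Qed.

Lemma Pset_P (a : U) : Pset M κ λ a <-> a ∈ PM M κ λ.
Proof.
rewrite in_P /Pset; split=> -[Ma [H1 H2]]; split=> //; split.
- by apply/(subset_sub HM).
- by apply/small_card_lt.
- by apply/(subset_sub HM).
- by apply/small_card_lt.
Qed.

Lemma P_sub (a b : U) : M a -> b ∈ PM M κ λ -> sub a b -> a ∈ PM M κ λ.
Proof.
move=> Ma /in_P [_ [bl sb]] ab; apply/in_P; split=> //; split.
  by move=> z /ab /bl.
exact: small_sub sb.
Qed.

Lemma Ord_Un (x : U) : M x -> sub x κ -> Ord (Un x).
Proof.
move=> Mx xk; have E := in_Un HM x _ Mx; split.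
  move=> y /E [z [zx yz]] w wy; apply/E; exists z; split=> //.
  exact: (Ord_trans z y) (Ord_mem _ _ Ok (xk _ zx)) yz wy.
move=> y y' /E [z [zx yz]] /E [z' [zx' yz']].
apply: (proj2 Ok).
  exact: (Ord_trans κ z) (xk _ zx) yz.
exact: (Ord_trans κ z') (xk _ zx') yz'.
Qed.

Lemma le_of_sub (β : U) : Ord β -> sub β λ -> ~ β ∈ κ -> sub κ β.
Proof.
move=> Ob bl nb.
have [bl'|El] := Ord_sub_cases _ _ Ol Ob bl.
  have [kl|Ek] := set_kl _ _ _ HS; last by rewrite Ek in nb.
  have [kb|[<-//|//]] := proj2 Ol κ β kl bl'.
  exact: Ord_mem_sub.
rewrite El; have [kl|-> //] := set_kl _ _ _ HS; exact: Ord_mem_sub.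
Qed.

(* Collapse the union to an ordinal [β]; if [β] were at least [κ], then [κ]
   would be a small union of small, hence bounded, subsets. *)
Lemma small_Un (Z : U) : M Z -> small M κ Z ->
  (forall z, z ∈ Z -> sub z λ /\ small M κ z) -> small M κ (Un Z).
Proof.
move=> MZ sZ HZ; have Mu := Un_closed HM _ MZ.
have E := in_Un HM Z _ MZ.
have [|β [Mb [Ob [bl [c [Mc [C1 [C2 C3]]]]]]]] := collapse HM (Un Z) λ Mu Ml Ol.
  by move=> x /E [z [zZ xz]]; apply: (proj1 (HZ z zZ)).
have [bk|nb] := classic (β ∈ κ); first by exists β; split=> //; exists c.
have kb := le_of_sub _ Ob bl nb.
have Hc : DefT M (fun e => app c (e 0)) by defn HM.
(* The indices below [κ] of the points of [z]. There are few of them, so by regularity their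
   supremum [Un (k z)] lies in [κ]. *)
pose k z := cap (img z (app c)) κ.
have Hk : DefT M (fun e => k (e 0)) by rewrite /k; defn HM.
have in_k z i : M z -> (i ∈ k z <-> (exists x, x ∈ z /\ i = app c x) /\ i ∈ κ).
  move=> Mz; rewrite (in_cap HM) //; first exact: (img_closed HM).
  by rewrite (in_img HM).
have Mkz z : M z -> M (k z) by move=> Mz; exact: (DefT_fun_closed k).
have kk z : M z -> sub (k z) κ by move=> Mz i /(in_k _ _ Mz) [].
have sk z : z ∈ Z -> Un (k z) ∈ κ.
  move=> zZ; have Mz := Tr _ _ MZ zZ.
  have [|γ [gk kg]] := set_reg _ _ _ HS (k z) (Mkz z Mz) (kk z Mz).
    apply: (small_image _ z (app c)) => //; auto; first exact: (proj2 (HZ z zZ)).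
    by move=> w /(in_k _ _ Mz) [].
  have Og := Ord_mem _ _ Ok gk.
  have [||H|-> //] := Ord_sub_cases γ (Un (k z)) Og.
  - by apply: Ord_Un; auto.
  - move=> i /(in_Un HM _ _ (Mkz z Mz)) [j [/kg jg ij]].
    exact: (Ord_trans γ j).
  - exact: (Ord_trans κ γ).
have HUk : DefT M (fun e => Un (k (e 0))) by apply: (DefT_Un HM).
pose X := img Z (fun z => Un (k z)).
have MX : M X by exact: (img_closed HM).
have in_X w : w ∈ X <-> exists z, z ∈ Z /\ w = Un (k z) by rewrite (in_img HM).
have [||γ [gk Xg]] := set_reg _ _ _ HS X MX.
- by move=> w /in_X [z [zZ ->]]; apply: sk.
- by apply: (small_image _ Z (fun z => Un (k z))) => // w /in_X.
(* The bound [γ] of all the suprema is itself the index of a point of some [z]; then [Un (k z)] is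
   in [γ], and [γ] is in [k z], so [Un (k z)] would be a member of itself. *)
- have [x [/E [z [zZ xz]] Eg]] := C3 γ (kb _ gk).
  have Mz := Tr _ _ MZ zZ.
  have Hz : Un (k z) ∈ γ by apply: Xg; apply/in_X; exists z.
  case: (mem_irrefl (Un (k z))); apply/(in_Un HM); first exact: Mkz.
  by exists γ; split=> //; apply/in_k => //; split=> //; exists x.
Qed.

Lemma small_upair (a b : U) : M a -> M b -> small M κ (upair a b).
Proof.
move=> Ma Mb.
have [β0 b0] := set_ne _ _ _ HS.
have [β1 [b1 b01]] := set_lim _ _ _ HS β0 b0.
have [β2 [b2 b12]] := set_lim _ _ _ HS β1 b1.
have M0 := Tr _ _ Mk b0; have M1 := Tr _ _ Mk b1.
have Mc := cup_closed HM _ _ M0 M1.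
exists β2; split=> //.
(* A definition by cases as a single separation: [a] goes to [β0], everything else to [β1]. *)
pose t z := sep (cup β0 β1) (fun w => (z = a /\ w ∈ β0) \/ (z <> a /\ w ∈ β1)).
have ta : t a = β0.
  apply: set_ext => w; rewrite (in_sep HM) //; first defn HM.
  rewrite (in_cup HM) //; tauto.
have tb : b <> a -> t b = β1.
  move=> ba; apply: set_ext => w; rewrite (in_sep HM) //; first defn HM.
  rewrite (in_cup HM) //; tauto.
have O2 := Ord_mem _ _ Ok b2.
have ne : β0 <> β1 by move=> E0; rewrite E0 in b01; exact: (mem_irrefl β1).
apply: (inj_intro HM _ _ t); first exact: (upair_closed HM).
- rewrite /t; defn HM.
- move=> z /(in_upair HM _ _ _ Ma Mb) H; have [Ez|nz] := classic (z = a).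
    by rewrite Ez ta; apply: (Ord_trans β2 β1).
  by case: H => // ?; subst z; rewrite tb.
- move=> z z' /(in_upair HM _ _ _ Ma Mb) H /(in_upair HM _ _ _ Ma Mb) H'.
  have [Eb|nb] := classic (b = a); first by case: H => ->; case: H' => ->.
  have := tb nb => tb'.
  by case: H => ->; case: H' => ->; rewrite ?ta ?tb' // => E0; case: ne.
Qed.

Lemma P_Un (Z : U) : M Z -> small M κ Z -> sub Z (PM M κ λ) ->
  Un Z ∈ PM M κ λ.
Proof.
move=> MZ sZ HZ; apply/in_P; split; first exact: (Un_closed HM).
split.
  by move=> x /(in_Un HM _ _ MZ) [z [/HZ /in_P [_ [zl _]] xz]]; apply: zl.
by apply: small_Un => // z /HZ /in_P [_ []].
Qed.

Lemma P_cup (a b : U) : a ∈ PM M κ λ -> b ∈ PM M κ λ -> cup a b ∈ PM M κ λ.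
Proof.
move=> aP bP; move/in_P: (aP) => [Ma _]; move/in_P: (bP) => [Mb _].
apply: P_Un; [exact: (upair_closed HM)|exact: small_upair|].
by move=> z /(in_upair HM _ _ _ Ma Mb) [->|->].
Qed.

Lemma P_sing (x : U) : x ∈ λ -> upair x x ∈ PM M κ λ.
Proof.
move=> xl; have Mx := Tr _ _ Ml xl.
apply/in_P; split; first exact: (upair_closed HM).
split; last exact: small_upair.
by move=> z /(in_upair HM _ _ _ Mx Mx) [->|->].
Qed.

(** Closure with sequences read through [app], so that any set of the model may serve as a
    sequence. *)
Definition chain_closed (C : U) : Prop :=
  forall δ s, δ ∈ κ -> (exists ξ, ξ ∈ δ) -> M s ->
    (forall ξ, ξ ∈ δ -> app s ξ ∈ C) ->
    (forall ξ η, ξ ∈ δ -> η ∈ δ -> ξ ∈ η -> sub (app s ξ) (app s η)) ->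
    Un (img δ (app s)) ∈ C.

Lemma in_Un_img (δ s z : U) : M δ -> M s ->
  (z ∈ Un (img δ (app s)) <-> exists ξ, ξ ∈ δ /\ z ∈ app s ξ).
Proof.
move=> Md Ms; have Hs : DefT M (fun e => app s (e 0)) by defn HM.
rewrite (in_Un HM); first exact: (img_closed HM).
split.
  by move=> [y [/(in_img HM _ _ _ Md Hs) [ξ [xd ->]] zy]]; exists ξ.
move=> [ξ [xd zy]]; exists (app s ξ); split=> //.
by apply/(in_img HM) => //; exists ξ.
Qed.

Lemma closed_chain (C : U) : M C -> (closed M κ C <-> chain_closed C).
Proof.
move=> MC; split.
  move=> H δ s dk dne Ms HC Hmono; have Md := Tr _ _ Mk dk.
  have Hs : DefT M (fun e => app s (e 0)) by defn HM.
  have Mu : M (Un (img δ (app s))) by apply: (Un_closed HM); apply: (img_closed HM).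
  have Mlam : M (lam δ (app s)) by apply: (lam_closed HM).
  have E ξ x : M ξ -> M x -> (maps_to M (lam δ (app s)) ξ x <-> ξ ∈ δ /\ x = app s ξ).
    by move=> Mξ Mx; rewrite (maps_to_pr HM) // (pr_in_lam HM).
  apply: (H δ Md (lam δ (app s)) Mlam _ Mu dk).
  - by have [ξ xd] := dne; exists ξ; split=> //; apply: Tr xd.
  - exact: (lam_function_on HM).
  - by move=> ξ Mξ x Mx /(E _ _ Mξ Mx) [xd ->]; apply: HC.
  - move=> ξ Mξ η Mη x Mx y My /(E _ _ Mξ Mx) [xd ->] /(E _ _ Mη My) [yd ->] xy.
    by apply/(subset_sub HM); [apply: (app_closed HM)|apply: Hmono].
  - move=> z Mz; rewrite in_Un_img //; split.
      move=> [ξ [xd zx]]; have Mξ := Tr _ _ Md xd.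
      exists ξ; split=> //; exists (app s ξ).
      have Ma := app_closed HM _ _ Ms Mξ.
      by split=> //; split=> //; apply/E.
    by move=> [ξ [Mξ [x [Mx [/(E _ _ Mξ Mx) [xd ->] zx]]]]]; exists ξ.
move=> H δ Md s Ms u Mu dk [ξ0 [_ x0]] Hf HC Hmono Hu.
have Hm ξ x : M ξ -> M x -> (maps_to M s ξ x <-> ξ ∈ δ /\ x = app s ξ).
  by move=> Mξ Mx; apply: (function_on_maps HM _ (fun w => w ∈ δ)) => // z; apply: Tr.
have Ma ξ : ξ ∈ δ -> M (app s ξ).
  by move=> xd; apply: (app_closed HM) => //; apply: Tr xd.
suff -> : u = Un (img δ (app s)).
  apply: H => //; first by exists ξ0.
    move=> ξ xd; apply: (HC ξ (Tr _ _ Md xd) _ (Ma _ xd)).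
    by apply/Hm; auto; apply: Tr xd.
  move=> ξ η xd yd xy; apply/(subset_sub HM); first exact: Ma.
  apply: (Hmono ξ (Tr _ _ Md xd) η (Tr _ _ Md yd) _ (Ma _ xd) _ (Ma _ yd)) => //.
    by apply/Hm; auto; apply: Tr xd.
  by apply/Hm; auto; apply: Tr yd.
apply: set_ext => z; rewrite in_Un_img //; split.
  move=> zu; have Mz := Tr _ _ Mu zu.
  move/(Hu z Mz): zu => [ξ [Mξ [x [Mx [/(Hm _ _ Mξ Mx) [xd ->] zx]]]]].
  by exists ξ.
move=> [ξ [xd zx]]; apply/Hu; first by apply: Tr zx; apply: Ma.
exists ξ; split; first exact: Tr xd.
exists (app s ξ); split; first exact: Ma.
by split=> //; apply/Hm; auto; apply: Tr xd.
Qed.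

Lemma club_iff (C : U) : M C ->
  (club M κ λ C <-> sub C (PM M κ λ) /\
     (forall a, a ∈ PM M κ λ -> exists c, c ∈ C /\ sub a c) /\
     chain_closed C).
Proof.
move=> MC; rewrite /club closed_chain //; split=> -[H1 [H2 H3]]; split.
- by move=> c /H1 /Pset_P.
- split=> // a aP; have Ma : M a by move/in_P: aP => [].
  have [|c [Mc [cC ac]]] := H2 a Ma; first by apply/Pset_P.
  by exists c; split=> //; apply/(subset_sub HM).
- by move=> c /H1 /Pset_P.
- split=> // a Ma /Pset_P /H2 [c [cC ac]]; exists c; split; first exact: Tr cC.
  by split=> //; apply/(subset_sub HM).
Qed.

Lemma P_chain (δ s : U) : δ ∈ κ -> M s ->
  (forall ξ, ξ ∈ δ -> app s ξ ∈ PM M κ λ) ->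
  Un (img δ (app s)) ∈ PM M κ λ.
Proof.
move=> dk Ms HC; have Md := Tr _ _ Mk dk.
have Hs : DefT M (fun e => app s (e 0)) by defn HM.
have Mi : M (img δ (app s)) by apply: (img_closed HM).
have Hi z : z ∈ img δ (app s) -> exists ξ, ξ ∈ δ /\ z = app s ξ.
  by rewrite (in_img HM).
apply: P_Un => //; last by move=> z /Hi [ξ [xd ->]]; apply: HC.
apply: (small_image _ δ (app s)) => //.
exact: (small_of_index _ δ).
Qed.

Lemma P_club : club M κ λ (PM M κ λ).
Proof.
apply/club_iff; first exact: MP.
split; first by [].
split; first by move=> a aP; exists a; split.
by move=> δ s dk _ Ms HC _; apply: P_chain.
Qed.

Lemma stationary_sub (S : U) : stationary M κ λ S -> sub S (PM M κ λ).
Proof. by move=> [H _] a /H /Pset_P. Qed.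

(** The cone above [x] is a club. *)
Lemma stationary_cofinal (S x : U) : M S -> stationary M κ λ S ->
  x ∈ PM M κ λ -> exists a, a ∈ S /\ sub x a.
Proof.
move=> MS [_ HSt] xP; have Mx : M x by move/in_P: xP => [].
have Mp := MP.
have HD : Def M (fun e => sub x (e 0)) by rewrite /sub; defn HM.
pose C := sep (PM M κ λ) (sub x).
have MC : M C by exact: (sep_closed HM).
have in_C a : a ∈ C <-> a ∈ PM M κ λ /\ sub x a by rewrite (in_sep HM).
have [|a [Ma [aS /in_C [_ xa]]]] := HSt C MC; last by exists a.
apply/club_iff => //; split; first by move=> a /in_C [].
split.
  move=> a aP; have Ma : M a by move/in_P: aP => [].
  exists (cup a x); split.
    apply/in_C; split; first exact: P_cup.
    by move=> z zx; apply/(in_cup HM) => //; right.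
  by move=> z za; apply/(in_cup HM) => //; left.
move=> δ s dk [ξ xd] Ms HC _; apply/in_C; split.
  by apply: P_chain => // η /HC /in_C [].
have Md := Tr _ _ Mk dk.
move=> z zx; apply/in_Un_img => //; exists ξ; split=> //.
by have /in_C [_] := HC ξ xd; apply.
Qed.

(** Two members of [S] have an upper bound in [S], through which their entries are compared. *)
Lemma coherent_union (S E : U) : M S -> M E -> stationary M κ λ S ->
  (forall a, a ∈ S -> sub (app E a) a) ->
  (forall a b, a ∈ S -> b ∈ S -> sub a b -> app E a = cap (app E b) a) ->
  M (Un (img S (app E))) /\ sub (Un (img S (app E))) λ /\
  forall a, a ∈ S -> app E a = cap (Un (img S (app E))) a.
Proof.
move=> MS ME HSt Hsub Hcoh.
have HE : DefT M (fun e => app E (e 0)) by defn HM.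
have Mi : M (img S (app E)) by apply: (img_closed HM).
have Md : M (Un (img S (app E))) by apply: (Un_closed HM).
have inS a : a ∈ S -> a ∈ PM M κ λ by apply: stationary_sub.
split=> //; split.
  move=> z /(in_Un_img _ _ _ MS ME) [a [aS za]].
  by have /in_P [_ [H _]] := inS a aS; apply/H/(Hsub a aS).
move=> a aS; have Ma := Tr _ _ MS aS.
apply: set_ext => z; rewrite (in_cap HM) // in_Un_img //; split.
  by move=> za; split; [exists a|apply: Hsub za].
move=> [[b [bS zb]] za].
have Mb := Tr _ _ MS bS.
have [|c [cS abc]] := stationary_cofinal S (cup a b) MS HSt.
  by apply: P_cup; apply: inS.
have ac : sub a c by move=> w wa; apply: abc; apply/(in_cup HM); auto.
have bc : sub b c by move=> w wb; apply: abc; apply/(in_cup HM); auto.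
have Mc := Tr _ _ MS cS.
have MEc : M (app E c) by apply: (app_closed HM).
rewrite (Hcoh a c) //; apply/(in_cap HM) => //; split=> //.
by move: zb; rewrite (Hcoh b c) // => /(in_cap HM) [].
Qed.

End Small.

(** * Clubs generated by functions on finite sets *)

(* For sets of ordinals this is finiteness, and it yields induction on the
   maximum for arbitrary predicates, hence absoluteness. *)
Definition has_maxima {U : set_universe} (M : class U) (e : U) : Prop :=
  forall e', M e' -> sub e' e -> (exists m, m ∈ e') ->
    exists m, m ∈ e' /\ forall ξ, ξ ∈ e' -> ξ ∈ m \/ ξ = m.

Definition Fin {U : set_universe} (M : class U) (λ : U) : U :=
  sep (pow M λ) (has_maxima M).

(** The set [a] need not belong to [M]: with [M := V] the notion is applied to sets of [W], still
    with the finite sets of [V]. *)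
Definition fin_closed {U : set_universe} (M : class U) (λ f a : U) : Prop :=
  forall e, e ∈ Fin M λ -> sub e a -> sub (app f e) a.

Section FiniteSets.

Context {U : set_universe} {M : class U} {κ λ : U} (HS : setting M κ λ).

Let HM := set_model _ _ _ HS.
Let Mk := set_Mk _ _ _ HS.
Let Ml := set_Ml _ _ _ HS.
Let Ok := set_Ok _ _ _ HS.
Let Ol := set_Ol _ _ _ HS.
Let Tr := model_trans HM.

Lemma Def_has_maxima : Def M (fun e => has_maxima M (e 0)).
Proof.
apply: (Def_ext M (fun e => forall e', M e' -> sub e' (e 0) ->
  (exists m, M m /\ m ∈ e') ->
  exists m, m ∈ e' /\ forall ξ, ξ ∈ e' -> ξ ∈ m \/ ξ = m)).
  move=> e He; split=> H e' Me' se ne; apply: H => //.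
    by have [m me] := ne; exists m; split=> //; apply: Tr me.
  by have [m [_ me]] := ne; exists m.
rewrite /sub; defn HM.
Qed.

Lemma in_Fin (e : U) : e ∈ Fin M λ <-> M e /\ sub e λ /\ has_maxima M e.
Proof.
rewrite (in_sep HM); [exact: (pow_closed HM)|exact: Def_has_maxima|].
rewrite (in_pow HM) //; tauto.
Qed.

Lemma M_Fin : M (Fin M λ).
Proof. apply: (sep_closed HM); [exact: (pow_closed HM)|exact: Def_has_maxima]. Qed.

Lemma Fin_sub (e e' : U) : M e' -> sub e' e -> e ∈ Fin M λ -> e' ∈ Fin M λ.
Proof.
move=> Me' se /in_Fin [Me [el He]]; apply/in_Fin; split=> //; split.
  by move=> z /se /el.
by move=> x Mx xe; apply: He => // z /xe /se.
Qed.

(** Membership induction on an ordinal bound of [e]: without its maximum [ξ], the set is bounded by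
    [ξ]. No definability of [P] is asked for. *)
Lemma Fin_ind (P : U -> Prop) :
  (forall e, e ∈ Fin M λ -> (forall z, ~ z ∈ e) -> P e) ->
  (forall e ξ, e ∈ Fin M λ -> ξ ∈ e -> (forall η, η ∈ e -> η ∈ ξ \/ η = ξ) ->
     P (cap e ξ) -> P e) ->
  forall e, e ∈ Fin M λ -> P e.
Proof.
move=> H0 H1.
have key α : forall e, e ∈ Fin M λ -> sub e α -> P e.
  elim/(well_founded_ind (mem_wf U)): α => α IH e eF ea.
  have [ne|em] := classic (exists z, z ∈ e); last first.
    by apply: H0 => // z ze; apply: em; exists z.
  have /in_Fin [Me [el He]] := eF.
  have [ξ [xe Hx]] := He e Me (fun _ h => h) ne.
  have Mx := Tr _ _ Me xe.
  apply: (H1 e ξ) => //; apply: (IH ξ); first exact: ea.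
    by apply: (Fin_sub e) => //; [exact: (cap_closed HM)|move=> z /(in_cap HM _ _ _ Me Mx) []].
  by move=> z /(in_cap HM _ _ _ Me Mx) [].
by move=> e eF; apply: (key λ) => //; have /in_Fin [_ []] := eF.
Qed.

Lemma Fin_empty : empty λ ∈ Fin M λ.
Proof.
have H z := in_empty HM λ z Ml.
apply/in_Fin; split; first exact: (empty_closed HM).
split; first by move=> z /H.
by move=> e' _ se [m /se /H].
Qed.

Lemma Fin_add (e ξ : U) : e ∈ Fin M λ -> ξ ∈ λ ->
  cup e (upair ξ ξ) ∈ Fin M λ.
Proof.
move=> /in_Fin [Me [el He]] xl; have Mx := Tr _ _ Ml xl.
have Mu := upair_closed HM _ _ Mx Mx.
have E z : z ∈ cup e (upair ξ ξ) <-> z ∈ e \/ z = ξ.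
  by rewrite (in_cup HM) // (in_upair HM) //; tauto.
apply/in_Fin; split; first exact: (cup_closed HM).
split; first by move=> z /E [/el|->].
move=> e' Me' se ne; have Mc := cap_closed HM _ _ Me' Me.
have I z := in_cap HM e' e z Me' Me.
have [ne2|em] := classic (exists z, z ∈ cap e' e); last first.
  have only z : z ∈ e' -> z = ξ.
    move=> ze; have /E [ze'|//] := se z ze.
    by case: em; exists z; apply/I.
  have [m me] := ne; exists ξ; split; first by rewrite -(only m me).
  by move=> z /only; right.
have [|m [/I [me me'] Hm]] := He (cap e' e) Mc _ ne2; first by move=> z /I [].
have [xe|nx] := classic (ξ ∈ e'); last first.
  exists m; split=> // z ze; apply: Hm; apply/I; split=> //.
  by have /E [//|Ez] := se z ze; rewrite Ez in ze.
have [mx|Hx] := classic (m ∈ ξ).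
  exists ξ; split=> // z ze; have /E [ze'|->] := se z ze; last by right.
  have /I/Hm [zm|->] := conj ze ze'; last by left.
  by left; apply: (Ord_trans ξ m) => //; apply: Ord_mem xl.
exists m; split=> // z ze; have /E [ze'|->] := se z ze.
  by apply: Hm; apply/I.
have [|[->|]] := proj2 Ol ξ m xl (el m me'); by [left|right|].
Qed.

Lemma Fin_P (e : U) : e ∈ Fin M λ -> e ∈ PM M κ λ.
Proof.
move: e; apply: Fin_ind => e.
  move=> /in_Fin [Me [el He]] em.
  have [β0 b0] := set_ne _ _ _ HS.
  have b0l : β0 ∈ λ.
    by have [kl|<-//] := set_kl _ _ _ HS; apply: (Ord_trans λ κ).
  by apply: (P_sub HS _ (upair β0 β0)) => //; [apply: (P_sing HS)|move=> z /em].
move=> ξ /in_Fin [Me [el He]] xe Hx IH.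
have Mx := Tr _ _ Me xe.
have Mu := upair_closed HM _ _ Mx Mx; have Mc := cap_closed HM _ _ Me Mx.
apply: (P_sub HS _ (cup (cap e ξ) (upair ξ ξ))) => //.
  by apply: (P_cup HS) => //; apply: (P_sing HS); apply: el.
move=> z ze; rewrite (in_cup HM) // (in_cap HM) // (in_upair HM) //.
by case: (Hx z ze); tauto.
Qed.

(** The chain [t] is an arbitrary function of the metatheory, so finite sets of [V] may be caught in
    chains that exist in [W] only. *)
Lemma Fin_in_chain (δ : U) (t : U -> U) : Ord δ -> (exists ξ, ξ ∈ δ) ->
  (forall ξ η, ξ ∈ δ -> η ∈ δ -> ξ ∈ η -> sub (t ξ) (t η)) ->
  forall e, e ∈ Fin M λ -> (forall z, z ∈ e -> exists ξ, ξ ∈ δ /\ z ∈ t ξ) ->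
  exists ξ, ξ ∈ δ /\ sub e (t ξ).
Proof.
move=> Od [ξ0 x0] mono; apply: Fin_ind => e.
  by move=> _ em _; exists ξ0; split=> // z /em.
move=> ζ /in_Fin [Me _] ze Hz IH Hcov; have Mz := Tr _ _ Me ze.
have E z := in_cap HM e ζ z Me Mz.
have [|ξ1 [x1 H1]] := IH; first by move=> z /E [/Hcov].
have [ξ2 [x2 H2]] := Hcov ζ ze.
have [h|[h|h]] := proj2 Od ξ1 ξ2 x1 x2.
- exists ξ2; split=> // z zz; have [zl|-> //] := Hz z zz.
  by apply: (mono ξ1) => //; apply: H1; apply/E.
- subst ξ2; exists ξ1; split=> // z zz; have [zl|-> //] := Hz z zz.
  by apply: H1; apply/E.
- exists ξ1; split=> // z zz; have [zl|->] := Hz z zz.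
    by apply: H1; apply/E.
  exact: (mono ξ2).
Qed.

(** This permits recursion along proper inclusion of finite sets. *)
Lemma Fin_acc (e : U) : e ∈ Fin M λ ->
  Acc (fun y z => y ∈ Fin M λ /\ (sub y z /\ y <> z)) e.
Proof.
move: e; apply: Fin_ind => e.
  move=> _ em; constructor=> y [_ [ye ne]]; case: ne; apply: sub_antisym => // z.
  by move/em.
move=> ξ eF xe Hx A.
have /in_Fin [Me _] := eF; have Mx := Tr _ _ Me xe.
have Mc : M (cap e ξ) by apply: (cap_closed HM).
have Hcap : forall z, z ∈ e -> z ∈ cap e ξ \/ z = ξ.
  by move=> z ze; rewrite (in_cap HM) //; case: (Hx z ze); tauto.
(* Only the inclusion of [e] in [e0] together with [ξ] is kept, so that an inner induction can
   shrink [e0]: a proper subset of [e] containing [ξ] misses a point of [e0], and one without [ξ] is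
   a subset of [e0]. *)
move: (cap e ξ) A Mc Hcap => e0 A.
clear Hx xe Me; elim: A e eF => {}e0 A0 IH e eF M0 He.
constructor=> y [yF [ye yne]].
have /in_Fin [My _] := yF.
have [xy|xy] := classic (ξ ∈ y).
  have My0 : M (cap y e0) by apply: (cap_closed HM).
  have E z := in_cap HM y e0 z My M0.
  apply: (IH (cap y e0)) => //.
  - split.
      by apply: (Fin_sub y) => // z /E [].
    split; first by move=> z /E [].
    move=> Eq; apply: yne; apply: sub_antisym => // z /He [|-> //].
    by rewrite -{1}Eq => /E [].
  - by move=> z zy; have /He [ze|] := ye z zy; [left; apply/E|right].
have ye0 : sub y e0.
  by move=> z zy; have /He [//|Ez] := ye z zy; rewrite Ez in zy.
have [->|ne] := classic (y = e0); first by constructor.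
exact: A0.
Qed.

Definition fin_hull (f y : U) : U :=
  Un (img (sep (Fin M λ) (fun e => sub e y)) (app f)).

Lemma Def_sub2 (s t : (nat -> U) -> U) :
  DefT M s -> DefT M t -> Def M (fun e => sub (s e) (t e)).
Proof. by apply: Def_rel2; rewrite /sub; defn HM. Qed.

Lemma in_fin_hull (f y z : U) : M f -> M y ->
  (z ∈ fin_hull f y <-> exists e, e ∈ Fin M λ /\ sub e y /\ z ∈ app f e).
Proof.
move=> Mf My; have MF := M_Fin; have D2 := Def_sub2.
have HD : Def M (fun e => sub (e 0) y) by defn HM.
rewrite (in_Un_img HS) //; first exact: (sep_closed HM).
split=> -[e H]; exists e; move: H; rewrite (in_sep HM) //; tauto.
Qed.

Lemma DefT_fin_hull (f : U) : M f -> DefT M (fun e => fin_hull f (e 0)).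
Proof.
move=> Mf; have MF := M_Fin; have D2 := Def_sub2; rewrite /fin_hull; defn HM.
Qed.

Hypothesis Hpow : forall x, M x -> small M κ x -> small M κ (pow M x).

(** The finite subsets of [y] are counted crudely, as elements of [pow M y]; this is what [Hpow] is
    for. *)
Lemma fin_hull_P (f y : U) : M f ->
  (forall e, e ∈ Fin M λ -> app f e ∈ PM M κ λ) -> y ∈ PM M κ λ ->
  fin_hull f y ∈ PM M κ λ.
Proof.
move=> Mf Hf yP; have /(in_P HS) [My [yl sy]] := yP.
have MF := M_Fin; have D2 := Def_sub2.
have HD : Def M (fun e => sub (e 0) y) by defn HM.
have Hapf : DefT M (fun e => app f (e 0)) by defn HM.
have Ms : M (sep (Fin M λ) (fun e => sub e y)) by apply: (sep_closed HM).
have Mi : M (img (sep (Fin M λ) (fun e => sub e y)) (app f)) by apply: (img_closed HM).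
have Hi w : w ∈ img (sep (Fin M λ) (fun e => sub e y)) (app f) ->
    exists z, z ∈ sep (Fin M λ) (fun e => sub e y) /\ w = app f z.
  by move/(in_img HM _ _ _ Ms Hapf).
apply: (P_Un HS) => //.
  apply: (small_image HS _ _ (app f) _ Ms) => //.
  apply: (small_sub HS _ (pow M y)) => //; last exact: Hpow.
  move=> e /(in_sep HM _ _ _ MF HD) [eF ey]; apply/(in_pow HM) => //.
  by split=> //; have /in_Fin [] := eF.
by move=> z /Hi [e [/(in_sep HM _ _ _ MF HD) [eF _] ->]]; apply: Hf.
Qed.

(** Closing off along [w], an ordinal without largest element: a finite subset of the union lies in
    one stage, and its value is absorbed by every later stage. *)
Lemma fin_closed_cofinal (f w x : U) : M f ->
  (forall e, e ∈ Fin M λ -> app f e ∈ PM M κ λ) ->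
  w ∈ κ -> (exists n, n ∈ w) -> (forall n, n ∈ w -> exists m, m ∈ w /\ n ∈ m) ->
  x ∈ PM M κ λ -> exists a, a ∈ PM M κ λ /\ sub x a /\ fin_closed M λ f a.
Proof.
move=> Mf Hf wk [n0 n0w] wlim xP.
have Mw := Tr _ _ Mk wk; have Ow := Ord_mem _ _ Ok wk.
have /(in_P HS) [Mx _] := xP.
pose F' z := cup z (fin_hull f z).
have Hh := DefT_fun1 _ (DefT_fin_hull f Mf).
have HF' : DefT M (fun e => F' (e 0)) by rewrite /F'; defn HM.
have HF'1 := DefT_fun1 _ HF'.
have MF' z : M z -> M (F' z) by move=> Mz; apply: (DefT_fun_closed F').
have Mh z : M z -> M (fin_hull f z).
  by move=> Mz; apply: (DefT_fun_closed (fin_hull f)) => //; apply: DefT_fin_hull.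
have [||n _|h [Mh' Hrec]] := recursion HM w (fun y x => y ∈ x)
  (fun n s => cup x (Un (img n (fun m => F' (app s m))))) Mw.
- defn HM.
- defn HM.
- elim/(well_founded_ind (mem_wf U)): n => n IH.
  by constructor=> y [_ yx]; apply: IH.
have Mapp n : n ∈ w -> M (app h n) by move=> nw; apply: (app_closed HM) => //; apply: Tr nw.
have in_h n z : n ∈ w -> (z ∈ app h n <-> z ∈ x \/ exists m, m ∈ n /\ z ∈ F' (app h m)).
  move=> nw; have Mn := Tr _ _ Mw nw.
  have HD : Def M (fun e => e 0 ∈ n) by defn HM.
  have Hapf : DefT M (fun e => app h (e 0)) by defn HM.
  have Ms := sep_closed HM w (fun m => m ∈ n) Mw HD.
  have Ml' := lam_closed HM _ (app h) Ms Hapf.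
  have Hs : DefT M (fun e => F' (app (lam (sep w (fun m => m ∈ n)) (app h)) (e 0))) by defn HM.
  have Mi := img_closed HM n (fun m => F' (app (lam (sep w (fun m => m ∈ n)) (app h)) m)) Mn Hs.
  rewrite {1}Hrec // (in_cup HM) //; first exact: (Un_closed HM).
  have Eq m : m ∈ n -> app (lam (sep w (fun m => m ∈ n)) (app h)) m = app h m.
    move=> mn; rewrite (app_lam HM) //; apply/(in_sep HM) => //.
    by split=> //; apply: (Ord_trans w n).
  rewrite (in_Un HM) //; split=> -[|]; try by left.
    move=> [y [/(in_img HM _ _ _ Mn Hs) [m [mn ->]] zy]]; right.
    by exists m; rewrite Eq in zy.
  move=> [m [mn zm]]; right; exists (F' (app h m)); split=> //.
  by apply/(in_img HM) => //; exists m; rewrite Eq.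
have hP n : n ∈ w -> app h n ∈ PM M κ λ.
  elim/(well_founded_ind (mem_wf U)): n => n IH nw.
  have Mn := Tr _ _ Mw nw.
  have nk : n ∈ κ by apply: (Ord_trans κ w).
  have Ht : DefT M (fun e => F' (app h (e 0))) by defn HM.
  have Mi := img_closed HM n (fun m => F' (app h m)) Mn Ht.
  have I z := in_img HM n z (fun m => F' (app h m)) Mn Ht.
  suff -> : app h n = cup x (Un (img n (fun m => F' (app h m)))).
    apply: (P_cup HS) => //; apply: (P_Un HS) => //.
      apply: (small_image HS _ n (fun m => F' (app h m))) => //; last by move=> z /I.
      by apply: (small_of_index HS _ n).
    move=> z /I [m [mn ->]].
    have mw : m ∈ w by apply: (Ord_trans w n).
    apply: (P_cup HS); first exact: IH.
    by apply: fin_hull_P => //; apply: IH.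
  apply: set_ext => z; rewrite in_h // (in_cup HM) //; first exact: (Un_closed HM).
  rewrite (in_Un HM) //; split=> -[|]; try by left.
    by move=> [m [mn zm]]; right; exists (F' (app h m)); split=> //; apply/I; exists m.
  by move=> [y [/I [m [mn ->]] zy]]; right; exists m.
have mono m n : m ∈ w -> n ∈ w -> m ∈ n -> sub (app h m) (app h n).
  move=> mw nw mn z zm; apply/in_h => //; right; exists m; split=> //.
  by apply/(in_cup HM); auto.
exists (Un (img w (app h))); split; first exact: (P_chain HS).
split.
  by move=> z zx; apply/(in_Un_img HS) => //; exists n0; split=> //; apply/in_h; auto.
move=> e eF ea.
have [||n [nw en]] := Fin_in_chain w (app h) Ow _ mono e eF.
- by exists n0.
- by move=> z /ea /(in_Un_img HS _ _ _ Mw Mh').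
have [n' [nw' nn]] := wlim n nw.
move=> z ze; apply/(in_Un_img HS) => //; exists n'; split=> //.
apply/in_h => //; right; exists n; split=> //.
apply/(in_cup HM); auto; right.
by apply/in_fin_hull; auto; exists e.
Qed.

(** Closure of [C] is given for chains, while a hull is a directed union over finite sets. The
    induction in [key] reduces the latter to chains: it runs over an ordinal [α] into which [y]
    injects and carries along a finite set [e0] that absorbs the last point at successor stages. *)
Lemma club_generated (C : U) : M C -> club M κ λ C ->
  exists f, M f /\ (forall e, e ∈ Fin M λ -> app f e ∈ C) /\
    forall a, a ∈ PM M κ λ -> fin_closed M λ f a -> a ∈ C.
Proof.
move=> MC /(club_iff HS _ MC) [CP [Cunb Cch]].
have MP' := MP HS; have MF := M_Fin; have D2 := Def_sub2.
have [|H [MH HH]] := model_choice HM (PM M κ λ) C sub MP' MC _ Cunb; first defn HM.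
pose prd e := sep (Fin M λ) (fun y => sub y e /\ y <> e).
(* The value at [e] is a member of [C] above [e] and above the values at all proper subsets. Hence
   [f] is monotone, and the hull of a finite set [e] is just [app f e]. *)
have [|||f [Mf Hrec]] := recursion HM (Fin M λ) (fun y e => sub y e /\ y <> e)
  (fun e s => app H (cup e (Un (img (prd e) (app s))))) MF.
- defn HM.
- rewrite /prd; defn HM.
- exact: Fin_acc.
have Hapf : DefT M (fun e => app f (e 0)) by defn HM.
have Mprd e : M e -> M (prd e).
  by move=> Me; apply: (sep_closed HM) => //; defn HM.
have in_prd e y : M e -> (y ∈ prd e <-> y ∈ Fin M λ /\ sub y e /\ y <> e).
  by move=> Me; rewrite (in_sep HM) //; defn HM.
have {}Hrec e : e ∈ Fin M λ -> app f e = app H (cup e (Un (img (prd e) (app f)))).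
  move=> eF; have Me := Tr _ _ MF eF; rewrite {1}Hrec //; congr (app H (cup e (Un _))).
  have Ml' := lam_closed HM _ (app f) (Mprd e Me) Hapf.
  rewrite -/(prd e).
  apply: set_ext => z; rewrite !(in_img HM); auto; first defn HM.
  by split=> -[y [yp ->]]; exists y; rewrite (app_lam HM); auto.
have fC e : e ∈ Fin M λ -> app f e ∈ C /\ sub e (app f e) /\
    forall e', e' ∈ Fin M λ -> sub e' e -> sub (app f e') (app f e).
  move=> eF; elim: (Fin_acc e eF) (eF) => {}e _ IH {}eF.
  have Me := Tr _ _ MF eF; have Mp := Mprd e Me.
  have Mi := img_closed HM _ (app f) Mp Hapf.
  have I z := in_img HM _ z (app f) Mp Hapf.
  have fP y : y ∈ prd e -> app f y ∈ PM M κ λ.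
    by move=> /(in_prd _ _ Me) [yF Hy]; apply: CP; apply (IH y).
  have DP : cup e (Un (img (prd e) (app f))) ∈ PM M κ λ.
    apply: (P_cup HS); first exact: Fin_P.
    apply: (P_Un HS) => //; last by move=> z /I [y [yp ->]]; apply: fP.
    apply: (small_image HS _ (prd e) (app f)) => //; last by move=> z /I.
    have /(in_P HS) [_ [_ se]] := Fin_P e eF.
    apply: (small_sub HS _ (pow M e)) => //; last exact: Hpow.
    move=> y /(in_prd _ _ Me) [yF [ye _]]; apply/(in_pow HM) => //.
    by split=> //; apply: Tr yF.
  have [fe Dfe] := HH _ DP; rewrite -Hrec // in fe Dfe.
  split=> //; split.
    by move=> z ze; apply: Dfe; apply/(in_cup HM); auto; apply: (Un_closed HM).
  move=> e' eF' ee'; have [-> //|ne] := classic (e' = e).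
  move=> z ze; apply: Dfe; apply/(in_cup HM); auto; first exact: (Un_closed HM).
  right; apply/(in_Un_img HS) => //; exists e'; split=> //; exact/in_prd.
have inH := in_fin_hull f.
have HDh := DefT_fun1 _ (DefT_fin_hull f Mf).
have key α : α ∈ κ -> forall y e0, M y -> sub y λ -> inj M y α ->
    e0 ∈ Fin M λ -> fin_hull f (cup y e0) ∈ C.
  elim/(well_founded_ind (mem_wf U)): α => α IH ak y e0 My yl [g [Mg [G1 G2]]] eF.
  have Ma := Tr _ _ Mk ak; have Oa := Ord_mem _ _ Ok ak.
  have M0 := Tr _ _ MF eF; have Mye := cup_closed HM _ _ My M0.
  have inC z := in_cup HM y e0 z My M0.
  have Dy i : M i -> Def M (fun e => app g (e 0) ∈ i) by move=> Mi; defn HM.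
  pose yi i := sep y (fun z => app g z ∈ i).
  have in_yi i z : M i -> (z ∈ yi i <-> z ∈ y /\ app g z ∈ i).
    by move=> Mi; rewrite (in_sep HM) //; apply: Dy.
  have Myi i : M i -> M (yi i) by move=> Mi; apply: (sep_closed HM) => //; apply: Dy.
  have injyi i : M i -> inj M (yi i) i.
    move=> Mi; exists g; split=> //; split; first by move=> z /(in_yi _ _ Mi) [].
    by move=> z z' /(in_yi _ _ Mi) [zy _] /(in_yi _ _ Mi) [zy' _]; apply: G2.
  have yil i : M i -> sub (yi i) λ by move=> Mi z /(in_yi _ _ Mi) [/yl].
  have [[ξ0 x0]|em] := classic (exists ξ, ξ ∈ α); last first.
    suff -> : fin_hull f (cup y e0) = app f e0 by apply (fC e0).
    have E0 : cup y e0 = e0.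
      apply: set_ext => z; rewrite inC; split; last by right.
      by move=> [/G1 za|//]; case: em; exists (app g z).
    rewrite E0; apply: set_ext => z; rewrite inH //; split.
      by move=> [e [eF' [ee0 ze]]]; move: ze; apply (fC e0).
    by move=> ze; exists e0; split=> //; split.
  (* Successor case: the point of index [β], if there is one, moves from [y] to the finite part. *)
  have [[β [ba Hb]]|Hlim] := classic (exists β, β ∈ α /\ forall γ, γ ∈ α -> γ ∈ β \/ γ = β).
    have Mb := Tr _ _ Ma ba.
    have bk : β ∈ κ by apply: (Ord_trans κ α).
    have [[p [py Ep]]|np] := classic (exists p, p ∈ y /\ app g p = β).
      have Mp := Tr _ _ My py; have Mpp := upair_closed HM _ _ Mp Mp.
      have Fp : cup e0 (upair p p) ∈ Fin M λ by apply: Fin_add => //; apply: yl.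
      suff -> : cup y e0 = cup (yi β) (cup e0 (upair p p)) by apply: (IH β); auto.
      apply: set_ext => z; rewrite inC (in_cup HM); auto; first exact: (cup_closed HM).
      rewrite in_yi // (in_cup HM) // (in_upair HM) //; split.
        move=> [zy|]; last by tauto.
        have [?|Ez] := Hb _ (G1 z zy); first by left.
        by right; right; left; apply: G2 => //; rewrite Ep.
      by move=> [[]|[|]]; [left|right|case=> ->; left].
    suff -> : y = yi β by apply: (IH β); auto.
    apply: set_ext => z; rewrite in_yi //; split; last by case.
    move=> zy; split=> //; have [//|Ez] := Hb _ (G1 z zy).
    by case: np; exists z.
  have lim β : β ∈ α -> exists γ, γ ∈ α /\ β ∈ γ.
    move=> ba; apply NNPP => K; apply: Hlim; exists β; split=> // γ ga.
    have [bg|[->|gb]] := proj2 Oa β γ ba ga; [|by right|by left].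
    by case: K; exists γ.
  have Dyi : DefT M (fun e => yi (e 0)) by rewrite /yi; defn HM.
  have Dyi1 := DefT_fun1 _ Dyi.
  (* Limit case: the hulls of the initial segments form a chain of length [α] in [C], whose union is
     the hull of the whole. *)
  pose t i := fin_hull f (cup (yi i) e0).
  have Dt : DefT M (fun e => t (e 0)) by rewrite /t; defn HM.
  have Ms := lam_closed HM α t Ma Dt.
  have monoy i j z : i ∈ α -> j ∈ α -> i ∈ j -> z ∈ cup (yi i) e0 -> z ∈ cup (yi j) e0.
    move=> ia ja ij; have Mi := Tr _ _ Ma ia; have Mj := Tr _ _ Ma ja.
    have Oj := Ord_mem _ _ Oa ja.
    rewrite !(in_cup HM); auto; rewrite !in_yi //.
    move=> [[zy gz]|]; last by right.
    by left; split=> //; apply: (Ord_trans j i).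
  have Mcy i : i ∈ α -> M (cup (yi i) e0).
    by move=> ia; apply: (cup_closed HM) => //; apply: Myi; apply: Tr ia.
  suff -> : fin_hull f (cup y e0) = Un (img α (app (lam α t))).
    apply: Cch => //; first by exists ξ0.
      move=> i ia; rewrite (app_lam HM) //; have Mi := Tr _ _ Ma ia.
      by apply: (IH i); auto; apply: (Ord_trans κ α).
    move=> i j ia ja ij; rewrite !(app_lam HM) // => z.
    rewrite !inH; auto.
    move=> [e [eF' [ei ze]]]; exists e; split=> //; split=> // w /ei.
    exact: monoy.
  apply: set_ext => z; rewrite inH // (in_Un_img HS) //; split.
    move=> [e [eF' [ey ze]]].
    have [|||i [ia ei]] := Fin_in_chain α (fun i => cup (yi i) e0) Oa _ _ e eF'.
    - by exists ξ0.
    - by move=> i j ia ja ij w; apply: monoy.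
    - move=> w /ey /inC [wy|we].
        have [γ [ga gg]] := lim _ (G1 w wy).
        have Mg' := Tr _ _ Ma ga.
        by exists γ; split=> //; apply/(in_cup HM); auto; left; apply/in_yi.
      exists ξ0; split=> //; apply/(in_cup HM); auto.
      by apply: Myi; apply: Tr x0.
    - by exists i; split=> //; rewrite (app_lam HM) //; apply/inH; auto; exists e.
  move=> [i [ia]]; rewrite (app_lam HM) // inH; auto.
  have Mi := Tr _ _ Ma ia.
  move=> [e [eF' [ei ze]]]; exists e; split=> //; split=> // w /ei.
  rewrite inC (in_cup HM); auto; rewrite in_yi //; tauto.
exists f; split=> //; split; first by move=> e /fC [].
move=> a aP Hcl; have /(in_P HS) [Ma [al [α [ak Ia]]]] := aP.
have := key α ak a (empty λ) Ma al Ia Fin_empty.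
have Me := empty_closed HM _ Ml.
have -> : cup a (empty λ) = a.
  apply: set_ext => z; rewrite (in_cup HM) //; split; last by left.
  by case=> // /(in_empty HM _ _ Ml).
suff -> : fin_hull f a = a by [].
apply: set_ext => z; rewrite inH //; split.
  by move=> [e [eF [ea ze]]]; apply: Hcl ze.
move=> za; have Mz := Tr _ _ Ma za.
have E w := in_upair HM z z w Mz Mz.
(* As [e] is contained in [app f e], the singleton of [z] brings [z] into the hull. *)
have zF : upair z z ∈ Fin M λ.
  have M1 := upair_closed HM _ _ Mz Mz.
  apply: (Fin_sub (cup (empty λ) (upair z z))) => //.
    by move=> w ww; apply/(in_cup HM) => //; right.
  by apply: Fin_add; [apply: Fin_empty|apply: al].
exists (upair z z); split=> //; split; first by move=> w /E [->|->].
by apply: (proj1 (proj2 (fC _ zF))); apply/E; left.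
Qed.

End FiniteSets.

(** * Lifting effable lists *)

Section Lists.

Context {U : set_universe} {M : class U} {κ λ : U} (HS : setting M κ λ).

Let HM := set_model _ _ _ HS.
Let Tr := model_trans HM.

Lemma Plist_maps (D a d : U) : M D -> Plist M κ λ D -> M a -> M d ->
  (maps_to M D a d <-> a ∈ PM M κ λ /\ d = app D a).
Proof.
move=> MD [Hf _] Ma Md; rewrite -(Pset_P HS).
by apply: (function_on_maps HM) => // z [].
Qed.

Lemma Plist_sub (D a : U) : M D -> Plist M κ λ D -> a ∈ PM M κ λ ->
  sub (app D a) a.
Proof.
move=> MD HD aP; have /(in_P HS) [Ma _] := aP.
have Md := app_closed HM _ _ MD Ma.
apply/(subset_sub HM) => //; apply: (proj2 HD a Ma _ Md).
by apply/Plist_maps.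
Qed.

Lemma Plist_lam (t : U -> U) : DefT M (fun e => t (e 0)) ->
  (forall a, a ∈ PM M κ λ -> sub (t a) a) -> Plist M κ λ (lam (PM M κ λ) t).
Proof.
move=> Ht Hs; have MP' := MP HS; have Ml := lam_closed HM _ t MP' Ht.
have Hf : function_on M (lam (PM M κ λ) t) (Pset M κ λ).
  by apply: (lam_function_on HM) => // z _; apply: Pset_P.
split=> // a Ma d Md.
rewrite (function_on_maps HM _ (Pset M κ λ)) //; first by move=> z [].
rewrite (Pset_P HS) => -[aP ->]; rewrite (app_lam HM) //.
apply/(subset_sub HM); last exact: Hs.
exact: (DefT_fun_closed t).
Qed.

Lemma effable_app (A D : U) : M A -> M D -> Plist M κ λ D ->
  sub A (PM M κ λ) ->
  (effable M κ λ A D <-> forall S, M S -> sub S A -> stationary M κ λ S ->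
     exists a b, a ∈ S /\ b ∈ S /\ sub a b /\ app D a <> cap (app D b) a).
Proof.
move=> MA MD HD AP.
have aM a : a ∈ A -> M (app D a) by move=> /(Tr _ _ MA); apply: (app_closed HM).
split=> H S MS.
  move=> SA HSt.
  have [|a [Ma [b [Mb [da [Mda [db [Mdb [aS [bS [ab [ha [hb hn]]]]]]]]]]]]] := H S MS _ HSt.
    by apply/(subset_sub HM).
  exists a, b; split=> //; split=> //; split; first by apply/(subset_sub HM).
  move/(Plist_maps _ _ _ MD HD Ma Mda): ha => [_ Ea].
  move/(Plist_maps _ _ _ MD HD Mb Mdb): hb => [_ Eb].
  by subst da db; move=> E; apply: hn; apply/(is_inter_cap HM).
move=> /(subset_sub HM _ _ MS) SA HSt.
have [a [b [aS [bS [ab ne]]]]] := H S MS SA HSt.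
have Ma := Tr _ _ MS aS; have Mb := Tr _ _ MS bS.
have Mda := aM a (SA a aS); have Mdb := aM b (SA b bS).
exists a; split=> //; exists b; split=> //; exists (app D a); split=> //.
exists (app D b); split=> //; split=> //; split=> //.
split; first by apply/(subset_sub HM).
split; first by apply/Plist_maps => //; split=> //; apply/AP/SA.
split; first by apply/Plist_maps => //; split=> //; apply/AP/SA.
by move=> /(is_inter_cap HM _ _ _ Mda Mdb Ma).
Qed.

End Lists.

(** * Clubs, thinness and effability across the two models *)

Section Pair.

Context {U : set_universe} {V W : class U} {κ λ τ w : U}.
Context (SV : setting V κ λ) (SW : setting W κ λ) (HVW : class_incl V W).
Context (Hpow : forall x, V x -> small V κ x -> small V κ (pow V x)).
Context (wk : w ∈ κ) (wne : exists n, n ∈ w).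
Context (wlim : forall n, n ∈ w -> exists m, m ∈ w /\ n ∈ m).
Context (Hcov : forall x, x ∈ PM W κ λ -> exists z, z ∈ PM V κ λ /\ sub x z).
Context (tk : τ ∈ κ) (Happ : approximation_property V W τ).

Let HV := set_model _ _ _ SV.
Let HW := set_model _ _ _ SW.
Let Vk := set_Mk _ _ _ SV.
Let Vl := set_Ml _ _ _ SV.
Let Ok := set_Ok _ _ _ SV.
Let Ol := set_Ol _ _ _ SV.
Let TV := model_trans HV.
Let TW := model_trans HW.

Local Notation PV := (PM V κ λ).
Local Notation PW := (PM W κ λ).

Lemma small_up (x : U) : small V κ x -> small W κ x.
Proof.
move=> [α [ak [f [Vf H]]]]; exists α; split=> //; exists f; split=> //.
exact: HVW.
Qed.

Lemma P_up (a : U) : a ∈ PV -> a ∈ PW.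
Proof.
move=> /(in_P SV) [Va [al sa]]; apply/(in_P SW); split; first exact: HVW.
by split=> //; apply: small_up.
Qed.

(** Being a set of [V], [a] is small there as a subset of its cover. *)
Lemma P_down (a : U) : V a -> a ∈ PW -> a ∈ PV.
Proof.
by move=> Va /Hcov [z [zP az]]; apply: (P_sub SV _ z).
Qed.

(** The club of [W] consists of all small sets above [x] that are closed under a function generating
    [C]. It is unbounded because a set of [W] can be covered in [V] and its cover closed off
    there. *)
Lemma club_up (C x : U) : V C -> club V κ λ C -> x ∈ PV ->
  exists E, W E /\ club W κ λ E /\
    forall a, a ∈ E -> sub x a /\ (a ∈ PV -> a ∈ C).
Proof.
move=> VC HC xP.
have [f [Vf [fC fcl]]] := club_generated SV Hpow C VC HC.
have /(club_iff SV _ VC) [CP _] := HC.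
have Wf := HVW _ Vf; have WF := HVW _ (M_Fin SV).
have /(in_P SV) [Vx _] := xP; have Wx := HVW _ Vx.
have WP := MP SW.
pose Q a := sub x a /\ fin_closed V λ f a.
have HQ : Def W (fun e => Q (e 0)).
  have D2 := Def_sub2 SW.
  rewrite /Q /fin_closed; defn HW.
pose E := sep PW Q.
have WE : W E by apply: (sep_closed HW).
have inE a : a ∈ E <-> a ∈ PW /\ Q a by rewrite (in_sep HW).
exists E; split=> //; split; last first.
  by move=> a /inE [aP [xa acl]]; split=> // aV; apply: fcl.
apply/(club_iff SW) => //; split; first by move=> a /inE [].
split.
  move=> a /Hcov [z [zP az]].
  have /(in_P SV) [Vz _] := zP.
  have [||a' [aP' [xa' acl]]] := fin_closed_cofinal SV Hpow f w (cup z x) Vf _ wk wne wlim.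
  - by move=> e /fC /CP.
  - exact: (P_cup SV).
  have Ec y := in_cup HV z x y Vz Vx.
  exists a'; split; last by move=> y /az yz; apply: xa'; apply/Ec; left.
  apply/inE; split; first exact: P_up.
  by split=> // y yx; apply: xa'; apply/Ec; right.
move=> δ s dk dne Ws HE mono; have Wd := TW _ _ (HVW _ Vk) dk.
have Od := Ord_mem _ _ Ok dk.
apply/inE; split; first by apply: (P_chain SW) => // ξ /HE /inE [].
split.
  have [ξ xd] := dne; move=> z zx; apply/(in_Un_img SW) => //; exists ξ; split=> //.
  by have /inE [_ [H _]] := HE ξ xd; apply: H.
move=> e eF eu.
have [|ξ [xd ex]] := Fin_in_chain SV δ (app s) Od dne mono e eF.
  by move=> z /eu /(in_Un_img SW _ _ _ Wd Ws).
move=> z ze; apply/(in_Un_img SW) => //; exists ξ; split=> //.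
by have /inE [_ [_ H]] := HE ξ xd; apply: (H e).
Qed.

Lemma thin_traces (t : U -> U) : DefT W (fun e => t (e 0)) ->
  (forall a, a ∈ PW -> exists y, V y /\ t a = cap a y) ->
  thin W κ λ (lam PW t).
Proof.
move=> Ht Hy; have WP := MP SW.
have Wlam := lam_closed HW _ t WP Ht.
have ta a : a ∈ PW -> sub (t a) a.
  move=> aP; have [y [Vy ->]] := Hy a aP; have Wy := HVW _ Vy.
  have /(in_P SW) [Wa _] := aP.
  by move=> z /(in_cap HW _ _ _ Wa Wy) [].
have HL := Plist_lam SW t Ht ta.
have maps a d : W a -> W d -> (maps_to W (lam PW t) a d <-> a ∈ PW /\ d = t a).
  move=> Wa Wd; rewrite (Plist_maps SW) //; split=> -[aP ->]; rewrite (app_lam HW) //.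
have Ht1 := DefT_fun1 _ Ht.
exists PW; split=> //; split; first exact: (P_club SW).
move=> c Wc cP.
have [c' [cP' cc']] := Hcov c cP.
have /(in_P SV) [Vc' [_ sc']] := cP'.
have Vp := pow_closed HV _ Vc'; have Wp := HVW _ Vp.
have D2 := Def_sub2 SW.
pose Q x := exists a, a ∈ PW /\ (sub c a /\ x = cap (t a) c).
have HQ : Def W (fun e => Q (e 0)) by rewrite /Q; defn HW.
have Wpc := pow_closed HW _ Wc.
pose X := sep (pow W c) Q.
have WX : W X by apply: (sep_closed HW).
have Wt a : a ∈ PW -> W (t a) by move=> aP; apply: (DefT_fun_closed t) => //; apply: TW aP.
have inX x : x ∈ X <-> Q x.
  rewrite (in_sep HW) //; split; first by case.
  move=> HQx; split=> //; have [a [aP [ca ->]]] := HQx.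
  apply/(in_pow HW) => //; split; first by apply: (cap_closed HW); auto.
  by move=> z /(in_cap HW _ _ _ (Wt a aP) Wc) [].
exists X; split=> //; split.
  move=> x Wx; rewrite inX; split.
    move=> [a [aP [ca ->]]]; have Wa := TW _ _ WP aP.
    exists a; split=> //; exists (t a); split; first exact: Wt.
    split; first by apply/(Pset_P SW).
    split; first by apply/(subset_sub HW).
    split; first by apply/maps; auto.
    by apply/(is_inter_cap HW); auto; apply: (cap_closed HW); auto.
  move=> [a [Wa [d [Wd [aP [ca [ha hi]]]]]]].
  exists a; split; first by apply/(Pset_P SW).
  split; first by apply/(subset_sub HW).
  by move/(maps _ _ Wa Wd): ha => [_ <-]; apply/(is_inter_cap HW).
apply/(small_card_lt SW) => //.
apply: (small_image SW _ (pow V c') (fun p => cap p c)) => //.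
- by apply: small_up; apply: Hpow.
- defn HW.
move=> x /inX [a [aP [ca ->]]]; have [y [Vy Ey]] := Hy a aP.
have Wa := TW _ _ WP aP; have Wy := HVW _ Vy; have Wc' := HVW _ Vc'.
have Wi := cap_closed HW _ _ Wy Wc'.
have Wj := cap_closed HW _ _ Wa Wy.
(* Because [c] is contained in both [a] and [c'], the trace of [a ∩ y] on [c] equals that of
   [y ∩ c']. *)
exists (cap y c'); split.
  apply/(in_pow HV) => //; split; first exact: (cap_closed HV).
  by move=> z /(in_cap HV _ _ _ Vy Vc') [].
rewrite Ey; apply: set_ext => z; rewrite !(in_cap HW) //; split.
  by move=> [[_ zy] zc]; auto.
by move=> [[zy _] zc]; auto.
Qed.

Lemma effable_lift (B D : U) : V B -> sub B PV -> V D -> Plist V κ λ D ->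
  effable V κ λ B D ->
  exists A, (forall a, a ∈ A <-> (a ∈ PW /\ a ∉ PV) \/ a ∈ B) /\ I_IT W κ λ A.
Proof.
move=> VB BP VD HD Heff.
have WP := MP SW; have VP := MP SV; have WVP := HVW _ VP.
have WB := HVW _ VB; have WD := HVW _ VD.
have Vτ : V τ := TV _ _ Vk tk.
have Oτ : Ord τ := Ord_mem _ _ Ok tk.
have Vpl := pow_closed HV _ Vl; have Wpl := HVW _ Vpl.
have small_τ z : V z -> small V τ z -> small V κ z.
  move=> Vz [ν [nt iz]]; exists ν; split=> //; exact: (Ord_trans κ τ).
have Dsm : Def V (fun e => small V τ (e 0)) by rewrite /small /inj; defn HV.
pose Zs := sep (pow V λ) (small V τ).
have VZ : V Zs by apply: (sep_closed HV).
have inZ z : z ∈ Zs <-> V z /\ sub z λ /\ small V τ z.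
  by rewrite (in_sep HV) // (in_pow HV) //; tauto.
have WZ := HVW _ VZ.
(* That [a ∩ z] is not in [V] is expressed by the set parameter [pow V λ], and smallness of [z] in
   [V] by [Zs], so that the condition is a formula over [W]. *)
have [||h [Wh Hh]] := model_choice HW PW (pow V λ)
    (fun a z => a ∉ PV -> z ∈ Zs /\ cap a z ∉ pow V λ) WP Wpl.
- defn HW.
- move=> a aP; have /(in_P SW) [Wa [al _]] := aP.
  have [aV|naV] := classic (a ∈ PV).
    (* Default value: the condition is vacuous for [a ∈ PV]. *)
    exists (empty λ); split=> //; apply/(in_pow HV) => //.
    split; first exact: (empty_closed HV).
    by move=> z /(in_empty HV λ z Vl).
  apply NNPP => K; apply: naV; apply: P_down => //.
  apply: Happ => //; first by move=> y /al; apply: TV.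
  move=> z Vz _ /(card_lt_inj HV _ _ Vz Vτ Oτ) sz.
  apply NNPP => K'; apply: K; exists (cap z λ).
  have Vz' := cap_closed HV _ _ Vz Vl.
  have I y := in_cap HV z λ y Vz Vl.
  split; first by apply/(in_pow HV) => //; split=> // y /I [].
  move=> _; split.
    apply/inZ; split=> //; split; first by move=> y /I [].
    have [ν [nt iz]] := sz; exists ν; split=> //.
    by apply: (inj_trans HV _ z) => //; apply: (inj_sub HV) => // y /I [].
  move=> /(in_pow HV _ _ Vl) [Vi _]; apply: K'; exists (cap a (cap z λ)).
  split=> // y Wy; rewrite (in_cap HW) //; first exact: HVW.
  rewrite I; split; first by tauto.
  by move=> [ya yz]; split=> //; split=> //; apply: al.
pose t a := sep a (fun z => (a ∈ PV /\ z ∈ app D a) \/ (a ∉ PV /\ z ∈ app h a)).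
have Ht : DefT W (fun e => t (e 0)) by rewrite /t; defn HW.
have in_t a z : a ∈ PW ->
    (z ∈ t a <-> z ∈ a /\ ((a ∈ PV /\ z ∈ app D a) \/ (a ∉ PV /\ z ∈ app h a))).
  by move=> aP; have Wa := TW _ _ WP aP; rewrite (in_sep HW) //; defn HW.
have tV a : a ∈ PV -> t a = app D a.
  move=> aV; apply: set_ext => z; rewrite in_t; first exact: P_up.
  split; first by tauto.
  by move=> zD; split; [apply: (Plist_sub SV D)|left].
have tN a : a ∈ PW -> a ∉ PV -> t a = cap a (app h a).
  move=> aP aV; have Wa := TW _ _ WP aP.
  apply: set_ext => z; rewrite in_t // (in_cap HW) //; last by tauto.
  exact: (app_closed HW).
(* The common form of old and new entries; it gives thinness and also lets [V] see small pieces of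
   the branch. *)
have base a : a ∈ PW -> exists y, V y /\ sub y λ /\ t a = cap a y.
  move=> aP; have [aV|naV] := classic (a ∈ PV).
    have /(in_P SV) [Va [al _]] := aV.
    have VDa := app_closed HV _ _ VD Va.
    have Da := Plist_sub SV D a VD HD aV.
    exists (app D a); split=> //; split; first by move=> z /Da /al.
    rewrite tV //; apply: set_ext => z; rewrite (in_cap HV) //.
    by split=> [zD|[]//]; split=> //; apply: Da.
  have [/(in_pow HV _ _ Vl) [Vh hl] _] := Hh a aP.
  by exists (app h a); rewrite tN.
have ta a : a ∈ PW -> sub (t a) a by move=> aP z /(in_t _ _ aP) [].
pose A := sep PW (fun a => a ∉ PV \/ a ∈ B).
have HA : Def W (fun e => e 0 ∉ PV \/ e 0 ∈ B) by defn HW.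
have WA : W A by apply: (sep_closed HW).
have inA a : a ∈ A <-> (a ∈ PW /\ a ∉ PV) \/ a ∈ B.
  rewrite (in_sep HW) //; split; first by tauto.
  by move=> [|aB]; [tauto|split; [apply/P_up/BP|right]].
have AP : sub A PW by move=> a /(in_sep HW _ _ _ WP HA) [].
pose E := lam PW t.
have WE : W E := lam_closed HW PW t WP Ht.
have HE : Plist W κ λ E by apply: (Plist_lam SW).
have Et a : a ∈ PW -> app E a = t a by move=> aP; rewrite (app_lam HW).
exists A; split=> //; split=> //; split.
  by move=> a /AP /(Pset_P SW).
exists E; split=> //; split=> //; split.
  by apply: thin_traces => // a /base [y [? [_ ?]]]; exists y.
apply/(effable_app SW) => // S WS SA HSt.
apply NNPP => Hno.
have SP : sub S PW by move=> a /SA /AP.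
have coh a b : a ∈ S -> b ∈ S -> sub a b -> app E a = cap (app E b) a.
  by move=> aS bS ab; apply NNPP => ne; apply: Hno; exists a, b.
have EaS a : a ∈ S -> sub (app E a) a.
  by move=> /SP aP; rewrite Et //; apply: ta.
have [Wd [dl dE]] := coherent_union SW S E WS WE HSt EaS coh.
move: (Un (img S (app E))) Wd dl dE => d Wd dl dE.
have cof := stationary_cofinal SW S _ WS HSt.
have Vd : V d.
  apply: Happ => //; first by move=> y /dl; apply: TV.
  move=> z Vz _ /(card_lt_inj HV _ _ Vz Vτ Oτ) sz.
  have Vz' := cap_closed HV _ _ Vz Vl.
  have I y := in_cap HV z λ y Vz Vl.
  have zP : cap z λ ∈ PV.
    apply/(in_P SV); split=> //; split; first by move=> y /I [].
    apply: (small_sub SV _ z) => //; first by move=> y /I [].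
    exact: small_τ.
  (* For [a ∈ S] above [z ∩ λ], the set [d] agrees with the entry at [a] on [z], so that
     [d ∩ z = y ∩ z]. *)
  have [a [aS za]] := cof _ (P_up _ zP).
  have aP := SP a aS; have Wa := TW _ _ WP aP.
  have [y [Vy [yl Ey]]] := base a aP.
  have Wy := HVW _ Vy.
  exists (cap y z); split; first exact: (cap_closed HV).
  move=> x Wx; rewrite (in_cap HV) //.
  have dx : x ∈ a -> (x ∈ d <-> x ∈ y).
    move=> xa; have := dE a aS; rewrite Et // Ey => Eq.
    have : x ∈ cap a y <-> x ∈ cap d a by rewrite Eq.
    by rewrite !(in_cap HW) //; tauto.
  split.
    move=> [xy xz]; split=> //; apply/dx => //; apply: za; apply/I.
    by split=> //; apply: yl.
  move=> [xd xz]; split=> //; apply/dx => //; apply: za; apply/I.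
  by split=> //; apply: dl.
have [x [xP Hx]] : exists x, x ∈ PV /\ forall a, a ∈ S -> sub x a -> a ∈ PV.
  have [β [Vb [Ob [bl [c [Vc [C1 [C2 C3]]]]]]]] := collapse HV d λ Vd Vl Ol dl.
  have [bk|nb] := classic (β ∈ κ).
    exists d; split.
      by apply/(in_P SV); split=> //; split=> //; exists β; split=> //; exists c.
    move=> a aS da; apply NNPP => naV; have aP := SP a aS.
    have Wa := TW _ _ WP aP.
    (* The entry at [a] would be [d ∩ a = d], a member of [pow V λ], against the choice of
       [app h a]. *)
    have [_ []] := Hh a aP => // _; apply; rewrite -tN // -Et // dE //.
    suff -> : cap d a = d by apply/(in_pow HV).
    apply: set_ext => z; rewrite (in_cap HW) //; split; first by case.
    by move=> zd; split=> //; apply: da.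
  have kb := le_of_sub SV _ Ob bl nb.
  (* The set [e] below collects the points of [d] of index less than [μ]. If it were part of an
     entry at [a ∉ PV], it would lie in [app h a], and [pow V τ] would inject into [μ], [e],
     [app h a] and finally [τ]. *)
  have [μ [mk ipm]] : small V κ (pow V τ).
    by apply: Hpow => //; apply: (small_of_index SV _ τ).
  have Vm := TV _ _ Vk mk.
  have De : Def V (fun e => app c (e 0) ∈ μ) by defn HV.
  pose e := sep d (fun y => app c y ∈ μ).
  have Ve : V e by apply: (sep_closed HV).
  have inE y : y ∈ e <-> y ∈ d /\ app c y ∈ μ by rewrite (in_sep HV).
  exists e; split.
    apply/(in_P SV); split=> //; split; first by move=> y /inE [/dl].
    exists μ; split=> //; exists c; split=> //; split; first by move=> y /inE [].
    by move=> y y' /inE [yd _] /inE [yd' _]; apply: C2.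
  move=> a aS ea; apply NNPP => naV; have aP := SP a aS.
  have Wa := TW _ _ WP aP.
  have [_ []] := Hh a aP => // /inZ [Vz [_ [ν [nt iz]]]] _.
  apply: (Cantor HV τ Vτ).
  have Vpt := pow_closed HV _ Vτ.
  apply: (inj_trans HV _ μ) => //.
  apply: (inj_trans HV _ e) => //.
    have [||g [Vg Hg]] := model_choice HV μ e (fun i y => i = app c y) Vm Ve.
    - defn HV.
    - move=> i im; have ik : i ∈ κ by apply: (Ord_trans κ μ).
      have [y [yd Ei]] := C3 i (kb i ik).
      by exists y; split=> //; apply/inE; split=> //; rewrite -Ei.
    exists g; split=> //; split; first by move=> i /Hg [].
    by move=> i i' /Hg [_ Ei] /Hg [_ Ei'] Eg; rewrite Ei Ei' Eg.
  apply: (inj_trans HV _ (app h a)) => //.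
    apply: (inj_sub HV) => // y ye.
    have /inE [yd _] := ye.
    have : y ∈ app E a by rewrite dE //; apply/(in_cap HW) => //; split=> //; apply: ea.
    rewrite Et // tN // => /(in_cap HW _ _ _ Wa) []//.
    exact: HVW.
  apply: (inj_trans HV _ ν) => //; apply: (inj_sub HV); first exact: TV nt.
  exact: Ord_mem_sub.
(* Although [S] need not belong to [V], its trace on [V] beyond [x] is contained in this set, which
   does since [d] does. *)
pose T := sep B (fun a => app D a = cap d a).
have HT : Def V (fun e => app D (e 0) = cap d (e 0)) by defn HV.
have VT : V T by apply: (sep_closed HV).
have inT a : a ∈ T <-> a ∈ B /\ app D a = cap d a by rewrite (in_sep HV).
have TB : sub T B by move=> a /inT [].
have Tst : stationary V κ λ T.
  split; first by move=> a /TB /BP /(Pset_P SV).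
  move=> C VC HC; have [K [WK [HK KC]]] := club_up C x VC HC xP.
  have [a [_ [aS aK]]] := proj2 HSt K WK HK.
  have [xa aC] := KC a aK.
  have aV := Hx a aS xa.
  exists a; split; first exact: TV aV.
  split; last exact: aC.
  apply/inT; split.
    by have /inA [[_ //]|//] := SA a aS.
  by rewrite -tV // -Et; [apply: P_up|apply: dE].
have /(effable_app SV _ _ VB VD HD BP) H := Heff.
have [a [b [/inT [aB Ea] [/inT [bB Eb] [ab]]]]] := H T VT TB Tst.
apply; rewrite Ea Eb.
have Va := TV _ _ VB aB; have Vb := TV _ _ VB bB.
have Vdb := cap_closed HV _ _ Vd Vb.
apply: set_ext => z; rewrite !(in_cap HV) //; split; last by tauto.
by move=> [zd za]; split=> //; split=> //; apply: ab.
Qed.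

End Pair.

(** * Standing assumptions from inaccessibility, and the three claims *)

Lemma regular_bound {U : set_universe} {M : class U}
  (HM : transitive_ZFC_model M) (κ : U) :
  M κ -> regular M κ -> reg_bound M κ.
Proof.
move=> Mk [[Hord [[β0 [_ b0]] _]] Hreg] x Mx xk [α [ak [f [Mf [F1 F2]]]]].
have Ok : Ord κ by apply/(ordinal_Ord HM).
have Tr := model_trans HM; have Ma := Tr _ _ Mk ak.
(* The inverse of the injection [f], written through the members of the preimage; it is empty at
   indices that are not attained. *)
pose g i := sep κ (fun j => exists z, z ∈ x /\ (app f z = i /\ j ∈ z)).
have Hg : DefT M (fun e => g (e 0)) by rewrite /g; defn HM.
have in_g i j : M i -> (j ∈ g i <-> j ∈ κ /\ exists z, z ∈ x /\ (app f z = i /\ j ∈ z)).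
  by move=> Mi; rewrite (in_sep HM) //; defn HM.
have gz z : z ∈ x -> g (app f z) = z.
  move=> zx; have Mfz : M (app f z) by apply: (app_closed HM) => //; apply: Tr zx.
  apply: set_ext => j; rewrite in_g //; split.
    by move=> [_ [z' [zx' [E jz]]]]; rewrite (F2 z z').
  by move=> jz; split; [apply: (Ord_trans κ z); auto|exists z].
have Ml := lam_closed HM α g Ma Hg.
have maps i y : M i -> M y -> (maps_to M (lam α g) i y <-> i ∈ α /\ y = g i).
  by move=> Mi My; rewrite (maps_to_pr HM) // (pr_in_lam HM).
have [||β [_ [bk Hb]]] := Hreg α Ma (lam α g) Ml ak.
- exact: (lam_function_on HM).
- move=> i Mi y My /(maps _ _ Mi My) [ia ->].
  have [[z [zx <-]]|nz] := classic (exists z, z ∈ x /\ app f z = i).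
    by rewrite gz //; apply: xk.
  (* The default value, the empty set, is the least element of [κ], so [g] takes all its values in
     [κ]. *)
  have [|m [mk Hm]] := mem_min (fun m => m ∈ κ); first by exists β0.
  suff -> : g i = m by [].
  apply: set_ext => j; rewrite in_g //; split.
    by move=> [_ [z [zx [E _]]]]; case: nz; exists z.
  by move=> jm; case: (Hm j jm); apply: (Ord_trans κ m).
exists β; split=> // z zx.
have Mz := Tr _ _ Mx zx; have Mfz := app_closed HM _ _ Mf Mz.
apply: (Hb (app f z) Mfz z Mz); apply/maps => //; split; first exact: F1.
by rewrite gz.
Qed.

Lemma small_pow {U : set_universe} {M : class U} (HM : transitive_ZFC_model M)
  (κ x : U) : M κ -> Ord κ -> strong_limit M κ -> M x ->
  small M κ x -> small M κ (pow M x).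
Proof.
move=> Mk Ok Hsl Mx [α [ak ix]]; have Tr := model_trans HM.
have Ma := Tr _ _ Mk ak.
have [p [Mp [Hp cp]]] := Hsl α Ma ak.
have Ep : p = pow M α.
  apply: set_ext => z; rewrite (in_pow HM) //; split.
    move=> zp; have Mz := Tr _ _ Mp zp; split=> //.
    by apply/(subset_sub HM) => //; apply/Hp.
  by move=> [Mz za]; apply/Hp => //; apply/(subset_sub HM).
move/(card_lt_inj HM _ _ Mp Mk Ok): cp; rewrite Ep => -[β [bk ib]].
exists β; split=> //; apply: (inj_trans HM _ (pow M α)) => //.
  exact: (pow_closed HM).
exact: (inj_pow HM).
Qed.

Theorem theorem6p3 (U : set_universe) (V W : class U) (κ λ τ : U)
  (HV : transitive_ZFC_model V) (HW : transitive_ZFC_model W)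
  (HVW : class_incl V W)
  (Vκ : V κ) (Hκ : inaccessible V κ)
  (Hcov : covering_property V W κ)
  (Hτ : τ ∈ κ) (Happ : approximation_property V W τ)
  (Vλ : V λ) (Hλ : cardinal V λ) (Hκλ : κ ∈ λ \/ κ = λ) :
  (exists A, (forall a, a ∈ A <-> Pset W κ λ a /\ ~ Pset V κ λ a) /\
     I_IT W κ λ A) /\
  (forall A, F_IT V κ λ A -> F_IT W κ λ A) /\
  (ITP W κ λ -> ITP V κ λ).
Proof.
have [[Hok _] [[w [Vw [[[_ [[n0 [_ n0w]] wlim]] _] wk]]] [Hreg Hsl]]] := Hκ.
have TV := model_trans HV; have TW := model_trans HW.
have Wκ := HVW _ Vκ; have Wλ := HVW _ Vλ.
have Ok : Ord κ by apply/(ordinal_Ord HV).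
have Ol : Ord λ by case: Hλ => H _; apply/(ordinal_Ord HV).
have kne : exists β, β ∈ κ by exists w.
have klim β : β ∈ κ -> exists γ, γ ∈ κ /\ β ∈ γ.
  move=> bk; have [[_ [_ H]] _] := Hreg.
  by have [γ [_ ?]] := H β (TV _ _ Vκ bk) bk; exists γ.
have RV := regular_bound HV κ Vκ Hreg.
have cov x : W x -> subset_class x V -> small W κ x ->
    exists z, V z /\ small V κ z /\ sub x z.
  move=> Wx xV sx; have [|z [Vz [cz xz]]] := Hcov x Wx xV.
    by apply/(card_lt_inj HW).
  exists z; split=> //; split; first by apply/(card_lt_inj HV).
  by apply/(subset_sub HW).
have SV : setting V κ λ by constructor.
(* A small subset of [κ] in [W] is covered by a small set of [V], whose part below [κ] is bounded by
   regularity in [V]. *)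
have RW : reg_bound W κ.
  move=> x Wx xk sx; have [|z [Vz [sz xz]]] := cov x Wx _ sx.
    by move=> y /xk; apply: TV.
  have Vzk := cap_closed HV _ _ Vz Vκ.
  have I y := in_cap HV z κ y Vz Vκ.
  have [||β [bk zb]] := RV _ Vzk; first by move=> y /I [].
    by apply: (small_sub SV _ z) => // y /I [].
  by exists β; split=> // y yx; apply: zb; apply/I; auto.
have SW : setting W κ λ by constructor.
have Hpow x : V x -> small V κ x -> small V κ (pow V x) by apply: small_pow.
have PC x : x ∈ PM W κ λ -> exists z, z ∈ PM V κ λ /\ sub x z.
  move=> /(in_P SW) [Wx [xl sx]]; have [|z [Vz [sz xz]]] := cov x Wx _ sx.
    by move=> y /xl; apply: TV.
  have I y := in_cap HV z λ y Vz Vλ.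
  have Vzl := cap_closed HV _ _ Vz Vλ.
  exists (cap z λ); split; last by move=> y yx; apply/I; auto.
  apply/(in_P SV); split=> //; split; first by move=> y /I [].
  by apply: (small_sub SV _ z) => // y /I [].
have wl n : n ∈ w -> exists m, m ∈ w /\ n ∈ m.
  by move=> nw; have [m [_ ?]] := wlim n (TV _ _ Vw nw) nw; exists m.
have lift := effable_lift SV SW HVW Hpow wk (ex_intro _ n0 n0w) wl PC Hτ Happ.
have VP := MP SV; have PVP := Pset_P SV; have PWP := Pset_P SW.
have up := P_up SV SW HVW.
split; last split.
- have em z := in_empty HV λ z Vλ.
  have Ve := empty_closed HV _ Vλ.
  have Ht : DefT V (fun e => empty (e 0)) by defn HV.
  have Vl := lam_closed HV _ empty VP Ht.
  have [|||A [HA IA]] := lift (empty λ) (lam (PM V κ λ) empty) Ve _ Vl.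
  + by move=> z /em.
  + apply: (Plist_lam SV) => // a aP z; have /(in_P SV) [Va _] := aP.
    by move/(in_empty HV a z Va).
  (* The empty set has no stationary subset, since a stationary set meets the club [PM V κ λ]. *)
  + move=> S VS SA [_ HSt].
    have [a [_ [aS _]]] := HSt _ VP (P_club SV).
    by case: (em a); apply: SA => //; apply: TV aS.
  exists A; split=> // a; rewrite PVP PWP HA.
  by split=> [[//|/em//]|]; left.
- move=> A [VA [AP [B [VB [HB [_ [_ [D [VD [HD [_ Heff]]]]]]]]]]].
  have inB a : a ∈ B <-> a ∈ PM V κ λ /\ a ∉ A.
    rewrite -PVP; split=> H; first by apply/HB => //; apply: TV H.
    by apply/HB => //; case: H => -[].
  have BP : sub B (PM V κ λ) by move=> a /inB [].
  have [A' [HA' IA']] := lift B D VB BP VD HD Heff.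
  (* The lifted set consists of [PW] without [PV] and of [PV] without [A], which together make up
     the complement of [A] in [PW]. *)
  split; first exact: HVW.
  split; first by move=> a /AP /PVP /up /PWP.
  exists A'; split; first by case: IA'.
  split=> // a _; rewrite HA' inB PWP; split.
    move=> [[aW naV]|[aV naA]]; last by split=> //; apply: up.
    by split=> // /AP /PVP.
  move=> [aW naA]; have [aV|naV] := classic (a ∈ PM V κ λ); [right|left]; by split.
- move=> HITP D VD HD _; apply NNPP => Hno.
  have PP : sub (PM V κ λ) (PM V κ λ) by [].
  (* A stationary set on which [D] coheres would make the union of its entries an ineffable
     branch. *)
  have Heff : effable V κ λ (PM V κ λ) D.
    apply/(effable_app SV) => // S VS SP HSt; apply NNPP => Hcoh.
    have [||Vd [dl dE]] := coherent_union SV S D VS VD HSt.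
    + by move=> a /SP; apply: (Plist_sub SV).
    + by move=> a b aS bS ab; apply NNPP => ne; apply: Hcoh; exists a, b.
    apply: Hno; exists (Un (img S (app D))); split=> //.
    split; first by apply/(subset_sub HV).
    exists S; split=> //; split=> // a Va da Vda aS.
    move=> /(Plist_maps SV _ _ _ VD HD Va Vda) [_ ->].
    by apply/(is_inter_cap HV) => //; [apply: (app_closed HV)|apply: dE].
  have [A [HA [WA [AP [E [WE [HE [Hthin HEeff]]]]]]]] := lift _ D VP PP VD HD Heff.
  have AP' : sub A (PM W κ λ) by move=> a /AP /PWP.
  (* Here [A] is all of [PM W κ λ]. The branch makes [E] coherent on a stationary subset, which
     contradicts effability of the lifted list. *)
  have [d [Wd [dl [S [WS [HSt HS]]]]]] := HITP E WE HE Hthin.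
  have SP := stationary_sub SW S HSt.
  have SA : sub S A.
    move=> a aS; apply/HA; have [aV|naV] := classic (a ∈ PM V κ λ); first by right.
    by left; split=> //; apply: SP.
  have dE a : a ∈ S -> app E a = cap d a.
    move=> aS; have Wa := TW _ _ WS aS; have WEa := app_closed HW _ _ WE Wa.
    apply/(is_inter_cap HW) => //; apply: (HS a Wa _ WEa aS).
    by apply/(Plist_maps SW) => //; split=> //; apply: SP.
  have /(effable_app SW _ _ WA WE HE AP') H := HEeff.
  have [a [b [aS [bS [ab]]]]] := H S WS SA HSt.
  apply; rewrite !dE //.
  have Wa := TW _ _ WS aS; have Wb := TW _ _ WS bS.
  have Wdb := cap_closed HW _ _ Wd Wb.
  apply: set_ext => z; rewrite !(in_cap HW) //; split; last by tauto.
  by move=> [zd za]; split=> //; split=> //; apply: ab.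
Qed.
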